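(* Let $K$ be a field of characteristic zero and let $\mathcal H$ be a CTD-bialgebra over $K$. Let $\mathrm{Prim}\,\mathcal H$ be its primitive part, which is a (not necessarily unital) commutative algebra under the dot operation. Then the following are equivalent: (a) $\mathcal H$ is a connected CTD-bialgebra; (b) $\mathcal H$ is isomorphic to $U_{CTD}(\mathrm{Prim}\,\mathcal H)$ as a CTD-bialgebra; (c) $\mathcal H$ is cofree among the connected coalgebras: $\mathcal H\cong T^c(\mathrm{Prim}\,\mathcal H)$ as coalgebras.
   Context: All vector spaces and tensor products are over $K$. CTD-algebras. A commutative tridendriform algebra (CTD-algebra) is a vector space $A$ with two bilinear operations $\prec$ and $\cdot$ such that for all $x,y,z\in A$: $x\cdot y=y\cdot x$; $(x\prec y)\prec z=x\prec(y\prec z+z\prec y+y\cdot z)$; $(x\cdot y)\prec z=x\cdot(y\prec z)$; $(x\cdot y)\cdot z=x\cdot(y\cdot z)$. One puts $x*y:=x\prec y+y\prec x+x\cdot y$. A unital CTD-algebra is a vector space $A=K1\oplus\bar A$ where $\bar A$ (the augmentation ideal) is a CTD-algebra, with the operations extended by $1\cdot x=0=x\cdot 1$, $1\prec x=0$, $x\prec 1=x$ for $x\in\bar A$; $1\prec 1$ and $1\cdot 1$ are not defined, and $1$ is the unit for $*$. Morphisms of unital CTD-algebras are linear maps sending $1$ to $1$, augmentation ideal to augmentation ideal, and compatible with $\prec$ and $\cdot$. Tensor product. For unital CTD-algebras $A,B$, the space $A\otimes B$ (with unit $1\otimes1$ and augmentation ideal $\bar A\otimes K1\oplus K1\otimes\bar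 B\oplus\bar A\otimes\bar B$) is a unital CTD-algebra by $(a\otimes b)\prec(a'\otimes b')=(a\prec a')\otimes(b*b')$ and $(a\otimes b)\cdot(a'\otimes b')=(a\cdot a')\otimes(b*b')$, with the convention, when $a=a'=1$, $(1\otimes b)\prec(1\otimes b'):=1\otimes(b\prec b')$ and $(1\otimes b)\cdot(1\otimes b'):=1\otimes(b\cdot b')$. CTD-bialgebras. A CTD-bialgebra ($As^c$-$CTD$-bialgebra) is a vector space $\mathcal H=K1\oplus\overline{\mathcal H}$ with a structure of unital CTD-algebra and a structure of coassociative counital coalgebra $\Delta$ (the counit being the projection onto $K1$) with $\Delta(1)=1\otimes1$, such that, with $\Delta(x)=x_{(1)}\otimes x_{(2)}$ (sum understood), $\Delta(x\prec y)=x_{(1)}\prec y_{(1)}\otimes x_{(2)}*y_{(2)}$ and $\Delta(x\cdot y)=x_{(1)}\cdot y_{(1)}\otimes x_{(2)}*y_{(2)}$, using the convention above; i.e. $\Delta$ is a morphism of unital CTD-algebras. Primitives and connectedness. $\mathrm{Prim}\,\mathcal H:=\{x\in\mathcal H\mid\Delta(x)-x\otimes1-1\otimes x=0\}$. Put $F_0\mathcal H:=K1$ and, for $r\ge1$, $F_r\mathcal H:=\{x\in\mathcal H\mid\Delta(x)-x\otimes1-1\otimes x\in F_{r-1}\mathcal H\otimes F_{r-1}\mathcal H\}$. $\mathcal H$ is connected if $\mathcal H=\bigcup_{r\ge0}F_r\mathcal H$. Universal enveloping CTD-algebra. $U_{CTD}$ is the left adjoint of the forgetful functor from unital CTD-algebras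 to (not necessarily unital) commutative algebras sending $A=K1\oplus\bar A$ to $(\bar A,\cdot)$. Explicitly, $U_{CTD}(R)$ is the quotient of the free unital CTD-algebra $CTD(R)$ on the vector space $R$ by the relations identifying the product $ab\in R\subset CTD(R)$ with the dot product $a\cdot b$ in $CTD(R)$, for $a,b\in R$. It is a CTD-bialgebra with coproduct $\Delta$ the unique morphism of unital CTD-algebras $U_{CTD}(R)\to U_{CTD}(R)\otimes U_{CTD}(R)$ such that $\Delta(r)=r\otimes1+1\otimes r$ for $r\in R$. Cofree coalgebra. $T^c(V)$ is the tensor module $T(V)=\bigoplus_{n\ge0}V^{\otimes n}$ with the deconcatenation coproduct $\Delta(v_1\cdots v_n)=\sum_{i=0}^n v_1\cdots v_i\otimes v_{i+1}\cdots v_n$. *)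

(* Defs.v *)
From HB Require Import structures.
From mathcomp Require Import all_boot all_order all_algebra.
From mathcomp Require Import generic_quotient sesquilinear boolp.

Set Implicit Arguments.
Unset Strict Implicit.
Unset Printing Implicit Defensive.

Import GRing.Theory.
Local Open Scope ring_scope.
Local Open Scope quotient_scope.

Notation bilin := (bilinear_for *:%R *:%R).

Section LinearHypotheses.
Variables (K : fieldType).

Section Lin.
Variables (U V : lmodType K) (f : U -> V).
Hypothesis lf : linear f.

Lemma linhD : {morph f : x y / x + y}.
Proof. by move=> x y; rewrite -[x]scale1r lf !scale1r. Qed.

Lemma linh0 : f 0 = 0.
Proof. by apply: (addIr (f 0)); rewrite -linhD !add0r. Qed.

Lemma linhZ a x : f (a *: x) = a *: f x.
Proof. by rewrite -[a *: x]addr0 lf linh0 addr0. Qed.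

Lemma linhB : {morph f : x y / x - y}.
Proof. by move=> x y; rewrite -scaleN1r linhD linhZ scaleN1r. Qed.

Lemma linh_sum (I : Type) (r : seq I) (P : pred I) (F : I -> U) :
  f (\sum_(i <- r | P i) F i) = \sum_(i <- r | P i) f (F i).
Proof. exact: (big_morph f linhD linh0). Qed.

End Lin.

Lemma linh_comp (U V W : lmodType K) (g : V -> W) (f : U -> V) :
  linear g -> linear f -> linear (fun x => g (f x)).
Proof. by move=> lg lf a x y; rewrite lf lg. Qed.

Section Bilin.
Variables (U V W : lmodType K) (f : U -> V -> W).
Hypothesis bf : bilin f.

Lemma bilinDl x y v : f (x + y) v = f x v + f y v.
Proof. exact: (linhD (bf.1 v)). Qed.
Lemma bilinDr u x y : f u (x + y) = f u x + f u y.
Proof. exact: (linhD (bf.2 u)). Qed.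
Lemma bilinZl a u v : f (a *: u) v = a *: f u v.
Proof. exact: (linhZ (bf.1 v)). Qed.
Lemma bilinZr a u v : f u (a *: v) = a *: f u v.
Proof. exact: (linhZ (bf.2 u)). Qed.
Lemma bilin0l v : f 0 v = 0.
Proof. exact: (linh0 (bf.1 v)). Qed.
Lemma bilin0r u : f u 0 = 0.
Proof. exact: (linh0 (bf.2 u)). Qed.
Lemma bilinBl x y v : f (x - y) v = f x v - f y v.
Proof. exact: (linhB (bf.1 v)). Qed.
Lemma bilinBr u x y : f u (x - y) = f u x - f u y.
Proof. exact: (linhB (bf.2 u)). Qed.

Lemma bilin_flip : bilin (fun v u => f u v).
Proof. by split=> ?; [apply: bf.2 | apply: bf.1]. Qed.

End Bilin.

Lemma bilin_add (U V W : lmodType K) (f g : U -> V -> W) :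
  bilin f -> bilin g -> bilin (fun u v => f u v + g u v).
Proof.
move=> bf bg; split=> [v|u] a x y /=.
  by rewrite !(bilinDl bf, bilinDl bg, bilinZl bf, bilinZl bg) addrACA -scalerDr.
by rewrite !(bilinDr bf, bilinDr bg, bilinZr bf, bilinZr bg) addrACA -scalerDr.
Qed.

Lemma linear_add (U V : lmodType K) (f g : U -> V) :
  linear f -> linear g -> linear (fun x => f x + g x).
Proof.
move=> lf lg a x y /=.
by rewrite !(linhD lf, linhD lg, linhZ lf, linhZ lg) addrACA -scalerDr.
Qed.

Lemma mk_linear (U V : lmodType K) (f : U -> V) :
  {morph f : x y / x + y} -> (forall a x, f (a *: x) = a *: f x) -> linear f.
Proof. by move=> fD fZ a x y /=; rewrite fD fZ. Qed.
End LinearHypotheses.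

(* [presented rels] is the [K]-vector space with bilinear operations indexed by
   [O] that is generated by [X] subject to the relations [rels]: formal
   expressions modulo the least congruence [econg] that contains [rels] and makes
   the quotient a vector space with bilinear operations. It is used with [O]
   empty for tensor products and tensor modules. *)
Section Presentation.
Variables (K : fieldType) (X O : Type).

Inductive expr : Type :=
  | EGen of X
  | EZero
  | EAdd of expr & expr
  | EScale of K & expr
  | EOp of O & expr & expr.

HB.instance Definition _ := gen_eqMixin expr.
HB.instance Definition _ := gen_choiceMixin expr.

Variable rels : expr -> expr -> Prop.

Inductive econg : expr -> expr -> Prop :=
  | EC_rel s t of rels s t : econg s t
  | EC_refl s : econg s s
  | EC_sym s t of econg s t : econg t s
  | EC_trans s t u of econg s t & econg t u : econg s u
  | EC_add s s' t t' of econg s s' & econg t t' : econg (EAdd s t) (EAdd s' t')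
  | EC_scale a s s' of econg s s' : econg (EScale a s) (EScale a s')
  | EC_op o s s' t t' of econg s s' & econg t t' :
      econg (EOp o s t) (EOp o s' t')
  | EC_addA s t u : econg (EAdd s (EAdd t u)) (EAdd (EAdd s t) u)
  | EC_addC s t : econg (EAdd s t) (EAdd t s)
  | EC_add0 s : econg (EAdd EZero s) s
  | EC_addN s : econg (EAdd (EScale (-1) s) s) EZero
  | EC_scaleA a b s : econg (EScale a (EScale b s)) (EScale (a * b) s)
  | EC_scale1 s : econg (EScale 1 s) s
  | EC_scaleDr a s t :
      econg (EScale a (EAdd s t)) (EAdd (EScale a s) (EScale a t))
  | EC_scaleDl a b s :
      econg (EScale (a + b) s) (EAdd (EScale a s) (EScale b s))
  | EC_op_linl o a s s' t :
      econg (EOp o (EAdd (EScale a s) s') t)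
            (EAdd (EScale a (EOp o s t)) (EOp o s' t))
  | EC_op_linr o a s t t' :
      econg (EOp o s (EAdd (EScale a t) t'))
            (EAdd (EScale a (EOp o s t)) (EOp o s t')).

Definition econgb (s t : expr) : bool := `[< econg s t >].

Lemma econgb_equiv : equiv_class_of econgb.
Proof.
split=> [s|s t|t s u]; first exact/asboolP/EC_refl.
- by apply/asboolP/asboolP => h; apply: EC_sym.
- by move=> /asboolP h1 /asboolP h2; apply/asboolP; apply: EC_trans h1 h2.
Qed.

Canonical econgb_rel := EquivRelPack econgb_equiv.

Definition presented : Type := {eq_quot econgb_rel}.

HB.instance Definition _ := Choice.copy presented {eq_quot econgb_rel}.

Definition pclass (s : expr) : presented := \pi_({eq_quot econgb_rel}) s.
Definition pterm (x : presented) : expr := repr (x : {eq_quot econgb_rel}).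

Lemma pclassP s t : pclass s = pclass t <-> econg s t.
Proof.
split=> [/(@eqmodP _ econgb_rel)/asboolP //|h].
exact/(@eqmodP _ econgb_rel)/asboolP.
Qed.

Lemma ptermK x : pclass (pterm x) = x.
Proof. exact: reprK. Qed.

Lemma pterm_class s : econg (pterm (pclass s)) s.
Proof. by apply/pclassP; rewrite ptermK. Qed.

Definition padd (x y : presented) := pclass (EAdd (pterm x) (pterm y)).
Definition pscale a (x : presented) := pclass (EScale a (pterm x)).
Definition pop o (x y : presented) := pclass (EOp o (pterm x) (pterm y)).
Definition popp (x : presented) := pscale (-1) x.
Definition pzero := pclass EZero.

Lemma paddE s t : padd (pclass s) (pclass t) = pclass (EAdd s t).
Proof. by apply/pclassP/EC_add; apply: pterm_class. Qed.
Lemma pscaleE a s : pscale a (pclass s) = pclass (EScale a s).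
Proof. by apply/pclassP/EC_scale; apply: pterm_class. Qed.
Lemma popE o s t : pop o (pclass s) (pclass t) = pclass (EOp o s t).
Proof. by apply/pclassP/EC_op; apply: pterm_class. Qed.

Lemma pclass_ex x : {s | x = pclass s}.
Proof. by exists (pterm x); rewrite ptermK. Qed.

Lemma paddA : associative padd.
Proof.
move=> x y z; case: (pclass_ex x) (pclass_ex y) (pclass_ex z).
by move=> s -> [t ->] [u ->]; rewrite !paddE; apply/pclassP/EC_addA.
Qed.
Lemma paddC : commutative padd.
Proof.
move=> x y; case: (pclass_ex x) (pclass_ex y) => s -> [t ->].
by rewrite !paddE; apply/pclassP/EC_addC.
Qed.
Lemma padd0 : left_id pzero padd.
Proof.
move=> x; case: (pclass_ex x) => s ->.
by rewrite paddE; apply/pclassP/EC_add0.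
Qed.
Lemma paddN : left_inverse pzero popp padd.
Proof.
move=> x; case: (pclass_ex x) => s ->.
by rewrite /popp pscaleE paddE; apply/pclassP/EC_addN.
Qed.

HB.instance Definition _ := GRing.isZmodule.Build presented paddA paddC padd0 paddN.

Lemma pscaleA a b x : pscale a (pscale b x) = pscale (a * b) x.
Proof.
case: (pclass_ex x) => s ->.
by rewrite !pscaleE; apply/pclassP/EC_scaleA.
Qed.
Lemma pscale1 : left_id 1 pscale.
Proof.
move=> x; case: (pclass_ex x) => s ->.
by rewrite pscaleE; apply/pclassP/EC_scale1.
Qed.
Lemma pscaleDr : right_distributive pscale +%R.
Proof.
move=> a x y; case: (pclass_ex x) (pclass_ex y) => s -> [t ->].
by rewrite -[_ + _]/(padd _ _) -[RHS]/(padd _ _) !(paddE, pscaleE);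
   apply/pclassP/EC_scaleDr.
Qed.
Lemma pscaleDl x : {morph pscale^~ x : a b / a + b}.
Proof.
move=> a b; case: (pclass_ex x) => s ->.
by rewrite -[RHS]/(padd _ _) !pscaleE paddE; apply/pclassP/EC_scaleDl.
Qed.

HB.instance Definition _ := GRing.Zmodule_isLmodule.Build K presented
  pscaleA pscale1 pscaleDr pscaleDl.

Lemma pclass0 : pclass EZero = 0. Proof. by []. Qed.
Lemma pclassD s t : pclass (EAdd s t) = pclass s + pclass t.
Proof. by rewrite -paddE. Qed.
Lemma pclassZ a s : pclass (EScale a s) = a *: pclass s.
Proof. by rewrite -pscaleE. Qed.
Lemma pclass_op o s t : pclass (EOp o s t) = pop o (pclass s) (pclass t).
Proof. by rewrite -popE. Qed.

Lemma pop_bilin o : bilin (pop o).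
Proof.
split=> y a x z /=; case: (pclass_ex x) (pclass_ex y) (pclass_ex z).
  move=> s -> [t ->] [u ->]; rewrite -pclassZ -pclassD !popE -pclassZ -pclassD.
  exact/pclassP/EC_op_linl.
move=> s -> [t ->] [u ->]; rewrite -pclassZ -pclassD !popE -pclassZ -pclassD.
exact/pclassP/EC_op_linr.
Qed.

Definition pgen (x : X) : presented := pclass (EGen x).

Lemma presented_ind (P : presented -> Prop) :
  (forall x, P (pgen x)) -> P 0 -> (forall x y, P x -> P y -> P (x + y)) ->
  (forall a x, P x -> P (a *: x)) ->
  (forall o x y, P x -> P y -> P (pop o x y)) -> forall x, P x.
Proof.
move=> Pg P0 PD PZ PO x; case: (pclass_ex x) => s ->.
elim: s => [y||s hs t ht|a s hs|o s hs t ht].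
- exact: Pg.
- exact: P0.
- by rewrite pclassD; apply: PD.
- by rewrite pclassZ; apply: PZ.
- by rewrite pclass_op; apply: PO.
Qed.

Section Lift.
Variables (W : lmodType K) (g : X -> W) (op : O -> W -> W -> W).

Fixpoint evalE (s : expr) : W :=
  match s with
  | EGen x => g x
  | EZero => 0
  | EAdd s t => evalE s + evalE t
  | EScale a s => a *: evalE s
  | EOp o s t => op o (evalE s) (evalE t)
  end.

Definition plift (x : presented) : W := evalE (pterm x).

Hypothesis op_bilin : forall o, bilin (op o).
Hypothesis rels_ok : forall s t, rels s t -> evalE s = evalE t.

Lemma evalE_cong s t : econg s t -> evalE s = evalE t.
Proof.
elim=> //=.
- by move=> {}s {}t u _ -> _ ->.
- by move=> {}s s' {}t t' _ -> _ ->.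
- by move=> a {}s {}t _ ->.
- by move=> o {}s s' {}t t' _ -> _ ->.
- by move=> *; rewrite addrA.
- by move=> *; rewrite addrC.
- by move=> *; rewrite add0r.
- by move=> *; rewrite scaleN1r addNr.
- by move=> *; rewrite scalerA.
- by move=> *; rewrite scale1r.
- by move=> *; rewrite scalerDr.
- by move=> *; rewrite scalerDl.
- by move=> *; rewrite (op_bilin _).1.
- by move=> *; rewrite (op_bilin _).2.
Qed.

Lemma plift_class s : plift (pclass s) = evalE s.
Proof. exact/evalE_cong/pterm_class. Qed.

Lemma plift_gen x : plift (pgen x) = g x.
Proof. exact: plift_class. Qed.

Lemma plift_linear : linear plift.
Proof.
move=> a x y; case: (pclass_ex x) (pclass_ex y) => s -> [t ->].
by rewrite -pclassZ -pclassD !plift_class.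
Qed.

Lemma plift_op o x y : plift (pop o x y) = op o (plift x) (plift y).
Proof.
case: (pclass_ex x) (pclass_ex y) => s -> [t ->].
by rewrite -pclass_op !plift_class.
Qed.

End Lift.
End Presentation.

Arguments EGen {K X O}.
Arguments EZero {K X O}.
Arguments EAdd {K X O}.
Arguments EScale {K X O}.
Arguments EOp {K X O}.

Definition no_op (W : Type) (o : void) : W -> W -> W := match o with end.

Inductive tensor_rel (K : fieldType) (U V : lmodType K) :
    expr K (U * V) void -> expr K (U * V) void -> Prop :=
  | TR_linl a u u' v : tensor_rel (EGen (a *: u + u', v))
      (EAdd (EScale a (EGen (u, v))) (EGen (u', v)))
  | TR_linr a u v v' : tensor_rel (EGen (u, a *: v + v'))
      (EAdd (EScale a (EGen (u, v))) (EGen (u, v'))).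

Definition tensor (K : fieldType) (U V : lmodType K) : Type :=
  presented (@tensor_rel K U V).

HB.instance Definition _ (K : fieldType) (U V : lmodType K) :=
  GRing.Lmodule.on (tensor U V).

Definition tens (K : fieldType) (U V : lmodType K) (u : U) (v : V) : tensor U V :=
  pgen (@tensor_rel K U V) (u, v).

Notation "u ⊗ v" := (tens u v) (at level 40, left associativity) : ring_scope.

Section TensorTheory.
Variables (K : fieldType) (U V : lmodType K).

Lemma tens_bilin : bilin (@tens K U V).
Proof.
split=> [v a u u'|u a v v'].
  have /(EC_rel (rels := @tensor_rel K U V))/pclassP := TR_linl a u u' v.
  by rewrite pclassD pclassZ.
have /(EC_rel (rels := @tensor_rel K U V))/pclassP := TR_linr a u v v'.
by rewrite pclassD pclassZ.
Qed.

Definition tensDl := bilinDl tens_bilin.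
Definition tensDr := bilinDr tens_bilin.
Definition tensZl := bilinZl tens_bilin.
Definition tensZr := bilinZr tens_bilin.
Definition tens0l := bilin0l tens_bilin.
Definition tens0r := bilin0r tens_bilin.

Lemma tens_ind (P : tensor U V -> Prop) :
  (forall u v, P (u ⊗ v)) -> (forall x y, P x -> P y -> P (x + y)) ->
  forall x, P x.
Proof.
move=> Pt PD x.
suff [] : P x /\ forall a, P (a *: x) by [].
elim/presented_ind: x => [[u v]||x y [Px PZx] [Py PZy]|a x [Px PZx]|[]//].
- by split=> [|a]; [exact: Pt | have := Pt (a *: u) v; rewrite tensZl].
- by split=> [|a]; rewrite ?scaler0; have := Pt 0 0; rewrite tens0l.
- by split=> [|a]; rewrite ?scalerDr; apply: PD.
- by split=> [|b]; rewrite ?scalerA; apply: PZx.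
Qed.

Variable W : lmodType K.

Definition tlift (f : U -> V -> W) : tensor U V -> W :=
  plift (fun p => f p.1 p.2) (@no_op W).

Section TLift.
Variable f : U -> V -> W.
Hypothesis bf : bilin f.

Let no_op_bilin (o : void) : bilin (@no_op W o). Proof. by case: o. Qed.
Let f_rel s t : tensor_rel s t -> evalE (fun p : U * V => f p.1 p.2) (@no_op W) s
  = evalE (fun p => f p.1 p.2) (@no_op W) t.
Proof. by case=> * /=; rewrite ?bf.1 ?bf.2. Qed.

Lemma tlift_tens u v : tlift f (u ⊗ v) = f u v.
Proof. exact: (plift_gen no_op_bilin f_rel). Qed.

Lemma tlift_linear : linear (tlift f).
Proof. exact: (plift_linear no_op_bilin f_rel). Qed.

End TLift.

Lemma tens_ext (f g : tensor U V -> W) : linear f -> linear g ->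
  (forall u v, f (u ⊗ v) = g (u ⊗ v)) -> f =1 g.
Proof.
move=> lf lg fg x; elim/tens_ind: x => // x y hx hy.
by rewrite (linhD lf) (linhD lg) hx hy.
Qed.

End TensorTheory.

Definition tmap (K : fieldType) (U U' V V' : lmodType K) (f : U -> U')
    (g : V -> V') : tensor U V -> tensor U' V' :=
  tlift (fun u v => f u ⊗ g v).

Definition tassoc (K : fieldType) (U V W : lmodType K) :
    tensor (tensor U V) W -> tensor U (tensor V W) :=
  tlift (fun t w => tlift (fun u v => u ⊗ (v ⊗ w)) t).

Section TMapTheory.
Variable K : fieldType.

Lemma tmap_bilin (U U' V V' : lmodType K) (f : U -> U') (g : V -> V') :
  linear f -> linear g -> bilin (fun u v => f u ⊗ g v).
Proof.
by move=> lf lg; split=> [v|u] a x y; rewrite ?lf ?lg (tens_bilin _ _).1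
  || rewrite ?lf ?lg (tens_bilin _ _).2.
Qed.

Lemma tmap_linear (U U' V V' : lmodType K) (f : U -> U') (g : V -> V') :
  linear f -> linear g -> linear (tmap f g).
Proof. by move=> lf lg; apply/tlift_linear/tmap_bilin. Qed.

Lemma tmap_tens (U U' V V' : lmodType K) (f : U -> U') (g : V -> V') u v :
  linear f -> linear g -> tmap f g (u ⊗ v) = f u ⊗ g v.
Proof. by move=> lf lg; apply/tlift_tens/tmap_bilin. Qed.

Variables U V W : lmodType K.

Let tassoc_bilin1 (w : W) : bilin (fun (u : U) (v : V) => u ⊗ (v ⊗ w)).
Proof.
split=> [v|u] a x y; first by rewrite (tens_bilin _ _).1.
by rewrite (tens_bilin _ _).1 (tens_bilin _ _).2.
Qed.

Let tassoc_bilin2 :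
  bilin (fun (t : tensor U V) (w : W) => tlift (fun u v => u ⊗ (v ⊗ w)) t).
Proof.
split=> [w|t]; first exact/tlift_linear/tassoc_bilin1.
move=> a x y /=; elim/tens_ind: t => [u v|s t hs ht].
  by rewrite !tlift_tens // !(tens_bilin _ _).2.
by rewrite !(linhD (tlift_linear (tassoc_bilin1 _))) hs ht scalerDr addrACA.
Qed.

Lemma tassoc_linear : linear (@tassoc K U V W).
Proof. exact: (tlift_linear tassoc_bilin2). Qed.

Lemma tassoc_tens u v w : @tassoc K U V W ((u ⊗ v) ⊗ w) = u ⊗ (v ⊗ w).
Proof. by rewrite /tassoc !tlift_tens. Qed.

End TMapTheory.

Record ctd_laws (K : fieldType) (A : lmodType K) (I : A -> Prop)
    (prec dot : A -> A -> A) : Prop := CTDLaws {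
  ctd_dotC : forall x y, I x -> I y -> dot x y = dot y x;
  ctd_prec_prec : forall x y z, I x -> I y -> I z ->
    prec (prec x y) z = prec x (prec y z + prec z y + dot y z);
  ctd_dot_prec : forall x y z, I x -> I y -> I z ->
    prec (dot x y) z = dot x (prec y z);
  ctd_dotA : forall x y z, I x -> I y -> I z ->
    dot (dot x y) z = dot x (dot y z)
}.

HB.mixin Record isCTDAlgebra (K : fieldType) A of GRing.Lmodule K A := {
  nprec : A -> A -> A;
  ndot : A -> A -> A;
  nprec_bilin : bilin nprec;
  ndot_bilin : bilin ndot;
  nctd_laws : ctd_laws (fun=> True) nprec ndot
}.

#[short(type="ctdAlgType")]
HB.structure Definition CTDAlgebra (K : fieldType) :=
  {A of GRing.Lmodule K A & isCTDAlgebra K A}.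

(* The decomposition [A = K 1 ⊕ Abar] is given by [uone] and the projection
   [aug] onto [K 1], so that [Abar] is the kernel of [aug]. The operations are
   total and bilinear on [A]; their values at [(1, 1)], which are undefined in
   the mathematical notion, are fixed to 0, and the CTD identities are required
   on [Abar] only. *)
HB.mixin Record isUnitalCTD (K : fieldType) A of GRing.Lmodule K A := {
  uone : A;
  aug : A -> K;
  aug_linear : scalar aug;
  aug_one : aug uone = 1;
  prec : A -> A -> A;
  dot : A -> A -> A;
  prec_bilin : bilin prec;
  dot_bilin : bilin dot;
  aug_prec_bar : forall x y, aug x = 0 -> aug y = 0 -> aug (prec x y) = 0;
  aug_dot_bar : forall x y, aug x = 0 -> aug y = 0 -> aug (dot x y) = 0;
  uctd_laws : ctd_laws (fun x => aug x = 0) prec dot;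
  dot1x_bar : forall x, aug x = 0 -> dot uone x = 0;
  dotx1_bar : forall x, aug x = 0 -> dot x uone = 0;
  prec1x_bar : forall x, aug x = 0 -> prec uone x = 0;
  precx1_bar : forall x, aug x = 0 -> prec x uone = x;
  prec11 : prec uone uone = 0;
  dot11 : dot uone uone = 0
}.

#[short(type="uctdAlgType")]
HB.structure Definition UnitalCTD (K : fieldType) :=
  {A of GRing.Lmodule K A & isUnitalCTD K A}.

(* The last term vanishes on [Abar]; it makes [uone] a unit, [1 * 1 = 1] included. *)
HB.lock Definition star (K : fieldType) (A : uctdAlgType K) (x y : A) : A :=
  prec x y + prec y x + dot x y + (aug x * aug y) *: uone.

Record uctd_morphism (K : fieldType) (A B : uctdAlgType K) (f : A -> B) : Prop :=
  UCTDMorphism {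
  uctdm_linear : linear f;
  uctdm_one : f uone = uone;
  uctdm_bar : forall x, aug x = 0 -> aug (f x) = 0;
  uctdm_prec : forall x y, aug x = 0 -> aug y = 0 ->
    f (prec x y) = prec (f x) (f y);
  uctdm_dot : forall x y, aug x = 0 -> aug y = 0 ->
    f (dot x y) = dot (f x) (f y)
}.

Section UnitalCTDTheory.
Variables (K : fieldType) (A : uctdAlgType K).
Implicit Types (x y z : A) (a b : K).

Lemma augD x y : aug (x + y) = aug x + aug y.
Proof. by have := aug_linear 1 x y; rewrite /= scale1r mul1r. Qed.
Lemma aug0 : aug (0 : A) = 0.
Proof. by apply: (addIr (aug (0 : A))); rewrite -augD !add0r. Qed.
Lemma augZ a x : aug (a *: x) = a * aug x.
Proof. by have := aug_linear a x 0; rewrite /= addr0 aug0 addr0. Qed.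

Definition precDl := bilinDl (@prec_bilin K A).
Definition precDr := bilinDr (@prec_bilin K A).
Definition precZl := bilinZl (@prec_bilin K A).
Definition precZr := bilinZr (@prec_bilin K A).
Definition prec0l := bilin0l (@prec_bilin K A).
Definition prec0r := bilin0r (@prec_bilin K A).
Definition dotDl := bilinDl (@dot_bilin K A).
Definition dotDr := bilinDr (@dot_bilin K A).
Definition dotZl := bilinZl (@dot_bilin K A).
Definition dotZr := bilinZr (@dot_bilin K A).
Definition dot0l := bilin0l (@dot_bilin K A).
Definition dot0r := bilin0r (@dot_bilin K A).

Lemma uctd_ind (P : A -> Prop) : P uone -> (forall x, aug x = 0 -> P x) ->
  (forall x y, P x -> P y -> P (x + y)) -> (forall a x, P x -> P (a *: x)) ->
  forall x, P x.
Proof.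
move=> P1 Pb PD PZ x.
rewrite -(subrK (aug x *: uone) x); apply: PD; last exact: PZ.
by apply: Pb; rewrite -scaleNr augD augZ aug_one mulr1 addrN.
Qed.

Lemma starE x y :
  star x y = prec x y + prec y x + dot x y + (aug x * aug y) *: uone.
Proof. by rewrite star.unlock. Qed.

Lemma star_bilin : bilin (@star K A).
Proof.
rewrite star.unlock; apply: bilin_add.
  apply: bilin_add (@dot_bilin K A).
  by apply: bilin_add (@prec_bilin K A) _; apply/bilin_flip/prec_bilin.
split=> [y|x]; apply: mk_linear => [u v|a u].
- by rewrite augD mulrDl scalerDl.
- by rewrite augZ scalerA mulrA.
- by rewrite augD mulrDr scalerDl.
- by rewrite augZ scalerA mulrCA.
Qed.

Definition starDl := bilinDl star_bilin.
Definition starDr := bilinDr star_bilin.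
Definition starZl := bilinZl star_bilin.
Definition starZr := bilinZr star_bilin.

Lemma prec1x x : prec uone x = 0.
Proof.
elim/uctd_ind: x => [|x|x y hx hy|a x hx]; rewrite ?prec11 ?precDr ?precZr //.
- exact: prec1x_bar.
- by rewrite hx hy addr0.
- by rewrite hx scaler0.
Qed.
Lemma dot1x x : dot uone x = 0.
Proof.
elim/uctd_ind: x => [|x|x y hx hy|a x hx]; rewrite ?dot11 ?dotDr ?dotZr //.
- exact: dot1x_bar.
- by rewrite hx hy addr0.
- by rewrite hx scaler0.
Qed.
Lemma dotx1 x : dot x uone = 0.
Proof.
elim/uctd_ind: x => [|x|x y hx hy|a x hx]; rewrite ?dot11 ?dotDl ?dotZl //.
- exact: dotx1_bar.
- by rewrite hx hy addr0.
- by rewrite hx scaler0.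
Qed.

Lemma precx1 x : prec x uone = x - aug x *: uone.
Proof.
elim/uctd_ind: x => [|x hx|x y hx hy|a x hx].
- by rewrite prec11 aug_one scale1r subrr.
- by rewrite precx1_bar // hx scale0r subr0.
- by rewrite precDl hx hy augD scalerDl opprD addrACA.
- by rewrite precZl hx augZ scalerBr scalerA.
Qed.

Lemma dotC x y : dot x y = dot y x.
Proof.
elim/uctd_ind: x => [|x hx|x x' hx hx'|a x hx];
  rewrite ?dot1x ?dotx1 ?dotDl ?dotDr ?dotZl ?dotZr ?hx ?hx' //.
elim/uctd_ind: y => [|y hy|y y' hy hy'|a y hy];
  rewrite ?dot1x ?dotx1 ?dotDl ?dotDr ?dotZl ?dotZr ?hy ?hy' //.
exact: (ctd_dotC uctd_laws).
Qed.

Lemma aug_prec x y : aug (prec x y) = 0.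
Proof.
elim/uctd_ind: x => [|x hx|x x' hx hx'|a x hx];
  rewrite ?prec1x ?aug0 ?precDl ?precZl ?augD ?augZ ?hx ?hx' ?addr0 ?mulr0 //.
elim/uctd_ind: y => [|y hy|y y' hy hy'|a y hy];
  rewrite ?precDr ?precZr ?augD ?augZ ?hy ?hy' ?addr0 ?mulr0 //.
  by rewrite precx1_bar.
exact: aug_prec_bar.
Qed.

Lemma aug_dot x y : aug (dot x y) = 0.
Proof.
elim/uctd_ind: x => [|x hx|x x' hx hx'|a x hx];
  rewrite ?dot1x ?aug0 ?dotDl ?dotZl ?augD ?augZ ?hx ?hx' ?addr0 ?mulr0 //.
elim/uctd_ind: y => [|y hy|y y' hy hy'|a y hy];
  rewrite ?dotDr ?dotZr ?augD ?augZ ?hy ?hy' ?addr0 ?mulr0 //.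
  by rewrite dotx1 aug0.
exact: aug_dot_bar.
Qed.

Lemma aug_star x y : aug (star x y) = aug x * aug y.
Proof.
by rewrite starE !augD augZ !aug_prec aug_dot aug_one !add0r mulr1.
Qed.

Lemma starC x y : star x y = star y x.
Proof. by rewrite !starE [prec x y + _]addrC dotC mulrC. Qed.

Lemma star1x x : star uone x = x.
Proof.
by rewrite starE prec1x dot1x precx1 aug_one mul1r add0r addr0 subrK.
Qed.
Lemma starx1 x : star x uone = x.
Proof. by rewrite starC star1x. Qed.

Lemma star_bar x y : aug x = 0 -> star x y = prec x y + prec y x + dot x y.
Proof. by move=> hx; rewrite starE hx mul0r scale0r addr0. Qed.

Lemma prec_prec x y z : prec (prec x y) z = prec x (star y z).
Proof.
elim/uctd_ind: x => [|x hx|x x' hx hx'|a x hx];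
  rewrite ?prec1x ?prec0l ?precDl ?precZl ?hx ?hx' //.
elim/uctd_ind: y => [|y hy|y y' hy hy'|a y hy];
  rewrite ?starDl ?starZl ?precDr ?precZr ?precDl ?precZl ?hy ?hy' //.
  by rewrite precx1_bar // star1x.
elim/uctd_ind: z => [|z hz|z z' hz hz'|a z hz];
  rewrite ?starDr ?starZr ?precDr ?precZr ?hz ?hz' //.
  by rewrite precx1_bar ?aug_prec // starx1.
by rewrite star_bar // (ctd_prec_prec uctd_laws).
Qed.

Lemma dot_prec x y z : prec (dot x y) z = dot x (prec y z).
Proof.
elim/uctd_ind: x => [|x hx|x x' hx hx'|a x hx];
  rewrite ?dot1x ?prec0l ?dotDl ?dotZl ?precDl ?precZl ?hx ?hx' //.
elim/uctd_ind: y => [|y hy|y y' hy hy'|a y hy];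
  rewrite ?precDl ?precZl ?dotDr ?dotZr ?precDl ?precZl ?hy ?hy' //.
  by rewrite dotx1 prec1x prec0l dot0r.
elim/uctd_ind: z => [|z hz|z z' hz hz'|a z hz];
  rewrite ?precDr ?precZr ?dotDr ?dotZr ?hz ?hz' //.
  by rewrite !precx1_bar ?aug_dot.
exact: (ctd_dot_prec uctd_laws).
Qed.

Lemma dotA x y z : dot (dot x y) z = dot x (dot y z).
Proof.
elim/uctd_ind: x => [|x hx|x x' hx hx'|a x hx];
  rewrite ?dot1x ?dot0l ?dotDl ?dotZl ?hx ?hx' //.
elim/uctd_ind: y => [|y hy|y y' hy hy'|a y hy];
  rewrite ?dotDl ?dotZl ?dotDr ?dotZr ?dotDl ?dotZl ?hy ?hy' //.
  by rewrite dotx1 dot1x dot0l dot0r.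
elim/uctd_ind: z => [|z hz|z z' hz hz'|a z hz];
  rewrite ?dotDr ?dotZr ?hz ?hz' //.
  by rewrite !dotx1 dot0r.
exact: (ctd_dotA uctd_laws).
Qed.

Lemma starA x y z : star (star x y) z = star x (star y z).
Proof.
elim/uctd_ind: x => [|x hx|x x' hx hx'|a x hx];
  rewrite ?star1x ?starDl ?starZl ?hx ?hx' //.
elim/uctd_ind: z => [|z hz|z z' hz hz'|a z hz];
  rewrite ?starx1 ?starDr ?starZr ?hz ?hz' //.
have hzy : star y z = prec z y + prec y z + dot z y by rewrite starC star_bar.
rewrite [LHS]star_bar ?aug_star ?hx ?mul0r // [RHS]star_bar // -!prec_prec.
rewrite [star x y]star_bar // hzy !precDl !dotDl !dotDr.
rewrite (prec_prec y z x) [star z x]starC -prec_prec (prec_prec z y x).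
rewrite [star y x]starC -prec_prec dot_prec dotA [dot z y]dotC.
have -> : dot (prec x y) z = dot x (prec z y).
  by rewrite dotC -dot_prec [dot z x]dotC dot_prec.
have -> : dot (prec y x) z = prec (dot y z) x.
  by rewrite dotC -dot_prec [dot z y]dotC.
rewrite -!addrA; congr (_ + _).
rewrite [RHS]addrCA; congr (_ + _).
rewrite addrCA; congr (_ + _).
rewrite [RHS]addrA [RHS]addrC -!addrA.
by congr (_ + _); rewrite addrCA [RHS]addrCA [X in _ = _ + X]addrC.
Qed.

Lemma starAC x y z : star x (star y z) = star y (star x z).
Proof. by rewrite -starA [star x y]starC starA. Qed.

End UnitalCTDTheory.

Section UCTDMorphismTheory.
Variable K : fieldType.

Lemma mk_uctd_morphism (A B : uctdAlgType K) (f : A -> B) : linear f ->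
  f uone = uone -> (forall x, aug (f x) = aug x) ->
  {morph f : x y / prec x y} -> {morph f : x y / dot x y} -> uctd_morphism f.
Proof. by move=> lf f1 fa fp fd; split=> // x; rewrite fa. Qed.

Variables (A B C : uctdAlgType K) (f : A -> B).
Hypothesis fm : uctd_morphism f.
Let lf := uctdm_linear fm.

Lemma uctdm_aug x : aug (f x) = aug x.
Proof.
elim/uctd_ind: x => [|x hx|x y hx hy|a x hx].
- by rewrite (uctdm_one fm) !aug_one.
- by rewrite hx (uctdm_bar fm).
- by rewrite (linhD lf) !augD hx hy.
- by rewrite (linhZ lf) !augZ hx.
Qed.

Lemma uctdm_precT : {morph f : x y / prec x y}.
Proof.
move=> x y; elim/uctd_ind: x => [|x hx|x x' hx hx'|a x hx].
- by rewrite (uctdm_one fm) !prec1x (linh0 lf).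
- elim/uctd_ind: y => [|y hy|y y' hy hy'|a y hy].
  + by rewrite (uctdm_one fm) !precx1 uctdm_aug hx !scale0r !subr0.
  + exact: (uctdm_prec fm).
  + by rewrite !(linhD lf, precDr) hy hy'.
  + by rewrite !(linhZ lf, precZr) hy.
- by rewrite !(linhD lf, precDl) hx hx'.
- by rewrite !(linhZ lf, precZl) hx.
Qed.

Lemma uctdm_dotT : {morph f : x y / dot x y}.
Proof.
move=> x y; elim/uctd_ind: x => [|x hx|x x' hx hx'|a x hx].
- by rewrite (uctdm_one fm) !dot1x (linh0 lf).
- elim/uctd_ind: y => [|y hy|y y' hy hy'|a y hy].
  + by rewrite (uctdm_one fm) !dotx1 (linh0 lf).
  + exact: (uctdm_dot fm).
  + by rewrite !(linhD lf, dotDr) hy hy'.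
  + by rewrite !(linhZ lf, dotZr) hy.
- by rewrite !(linhD lf, dotDl) hx hx'.
- by rewrite !(linhZ lf, dotZl) hx.
Qed.

Lemma uctdm_star : {morph f : x y / star x y}.
Proof.
move=> x y; rewrite !starE !(linhD lf, linhZ lf) uctdm_dotT !uctdm_precT.
by rewrite (uctdm_one fm) !uctdm_aug.
Qed.

Lemma uctd_morphism_comp (g : B -> C) :
  uctd_morphism g -> uctd_morphism (fun x => g (f x)).
Proof.
move=> gm; split.
- exact: linh_comp (uctdm_linear gm) lf.
- by rewrite (uctdm_one fm) (uctdm_one gm).
- by move=> x hx; apply/(uctdm_bar gm)/(uctdm_bar fm).
- by move=> x y hx hy; rewrite (uctdm_prec fm) // (uctdm_prec gm) //;
     apply: (uctdm_bar fm).
- by move=> x y hx hy; rewrite (uctdm_dot fm) // (uctdm_dot gm) //;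
     apply: (uctdm_bar fm).
Qed.

End UCTDMorphismTheory.

(* [opA] vanishes on [(1, 1)] and [aug] on [Abar], so on [a ⊗ b] and [a' ⊗ b'],
   with each entry equal to 1 or in the augmentation ideal, this is
   [opA a a' ⊗ (b * b')], except when [a = a' = 1], where it is
   [1 ⊗ opB b b']. *)
Section TensorUCTD.
Variables (K : fieldType) (A B : uctdAlgType K).

Definition tens_op (opA : A -> A -> A) (opB : B -> B -> B) (x y : tensor A B) :
    tensor A B :=
  tlift (fun a b => tlift (fun a' b' =>
    opA a a' ⊗ star b b' + (aug a * aug a') *: (uone ⊗ opB b b')) y) x.

Section TensOp.
Variables (opA : A -> A -> A) (opB : B -> B -> B).
Hypotheses (bA : bilin opA) (bB : bilin opB).

Let op a b a' b' :=
  opA a a' ⊗ star b b' + (aug a * aug a') *: (uone ⊗ opB b b').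

Let opD1 a1 a2 b a' b' : op (a1 + a2) b a' b' = op a1 b a' b' + op a2 b a' b'.
Proof.
by rewrite /op (bilinDl bA) tensDl augD mulrDl scalerDl addrACA.
Qed.
Let opD2 a b1 b2 a' b' : op a (b1 + b2) a' b' = op a b1 a' b' + op a b2 a' b'.
Proof.
by rewrite /op (bilinDl bB) starDl !tensDr scalerDr addrACA.
Qed.
Let opD3 a b a1 a2 b' : op a b (a1 + a2) b' = op a b a1 b' + op a b a2 b'.
Proof.
by rewrite /op (bilinDr bA) tensDl augD mulrDr scalerDl addrACA.
Qed.
Let opD4 a b a' b1 b2 : op a b a' (b1 + b2) = op a b a' b1 + op a b a' b2.
Proof.
by rewrite /op (bilinDr bB) starDr !tensDr scalerDr addrACA.
Qed.
Let opZ1 k a b a' b' : op (k *: a) b a' b' = k *: op a b a' b'.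
Proof.
by rewrite /op (bilinZl bA) tensZl augZ -mulrA -scalerA scalerDr.
Qed.
Let opZ2 k a b a' b' : op a (k *: b) a' b' = k *: op a b a' b'.
Proof.
by rewrite /op (bilinZl bB) starZl !tensZr scalerDr !scalerA mulrC.
Qed.
Let opZ3 k a b a' b' : op a b (k *: a') b' = k *: op a b a' b'.
Proof.
by rewrite /op (bilinZr bA) tensZl augZ mulrCA scalerDr scalerA.
Qed.
Let opZ4 k a b a' b' : op a b a' (k *: b') = k *: op a b a' b'.
Proof.
by rewrite /op (bilinZr bB) starZr !tensZr scalerDr !scalerA mulrC.
Qed.

Let op_in a b : bilin (op a b).
Proof. by split=> ?; apply: mk_linear. Qed.

Let op_out y : bilin (fun a b => tlift (op a b) y).
Proof.
split=> [b|a]; apply: mk_linear => [u v|k u]; elim/tens_ind: y => [a' b'|s t hs ht];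
  rewrite ?(tlift_tens (op_in _ _)) // ?(linhD (tlift_linear (op_in _ _))) hs ht;
  by rewrite ?scalerDr // addrACA.
Qed.

Lemma tens_opE a b a' b' : tens_op opA opB (a ⊗ b) (a' ⊗ b') =
  opA a a' ⊗ star b b' + (aug a * aug a') *: (uone ⊗ opB b b').
Proof. by rewrite /tens_op (tlift_tens (op_out _)) (tlift_tens (op_in _ _)). Qed.

Lemma tens_op_bilin : bilin (tens_op opA opB).
Proof.
split=> [y|x]; first exact: (tlift_linear (op_out y)).
apply: mk_linear => [u v|k u].
  elim/tens_ind: x => [a b|s t hs ht].
    by rewrite /tens_op !(tlift_tens (op_out _)) (linhD (tlift_linear (op_in _ _))).
  by rewrite /tens_op !(linhD (tlift_linear (op_out _))) addrACA; congr (_ + _).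
elim/tens_ind: x => [a b|s t hs ht].
  by rewrite /tens_op !(tlift_tens (op_out _)) (linhZ (tlift_linear (op_in _ _))).
rewrite /tens_op !(linhD (tlift_linear (op_out _))) scalerDr; congr (_ + _);
  [exact: hs | exact: ht].
Qed.

End TensOp.

Definition tens_one : tensor A B := uone ⊗ uone.
Definition tens_aug (t : tensor A B) : K :=
  @tlift K A B K^o (fun a b => aug a * aug b) t.
Definition tens_prec := tens_op prec prec.
Definition tens_dot := tens_op dot dot.

Let taug_bilin : @bilinear_for K A B K^o *:%R *:%R (fun a b => aug a * aug b).
Proof.
split=> [b|a]; apply: mk_linear => [u v|k u]; rewrite ?augD ?augZ.
- by rewrite mulrDl.
- by rewrite -mulrA.
- by rewrite mulrDr.
- by rewrite mulrCA.
Qed.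

Lemma tens_augE a b : tens_aug (a ⊗ b) = aug a * aug b.
Proof. exact: (tlift_tens taug_bilin). Qed.
Lemma tens_aug_linear : linear (tens_aug : tensor A B -> (K^o : lmodType K)).
Proof. exact: (tlift_linear taug_bilin). Qed.

Lemma tens_precE a b a' b' : tens_prec (a ⊗ b) (a' ⊗ b') =
  prec a a' ⊗ star b b' + (aug a * aug a') *: (uone ⊗ prec b b').
Proof. exact: tens_opE (@prec_bilin K A) (@prec_bilin K B) _ _ _ _. Qed.
Lemma tens_dotE a b a' b' : tens_dot (a ⊗ b) (a' ⊗ b') =
  dot a a' ⊗ star b b' + (aug a * aug a') *: (uone ⊗ dot b b').
Proof. exact: tens_opE (@dot_bilin K A) (@dot_bilin K B) _ _ _ _. Qed.
Lemma tens_prec_bilin : bilin tens_prec.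
Proof. exact: tens_op_bilin (@prec_bilin K A) (@prec_bilin K B). Qed.
Lemma tens_dot_bilin : bilin tens_dot.
Proof. exact: tens_op_bilin (@dot_bilin K A) (@dot_bilin K B). Qed.

End TensorUCTD.

Section TensorUCTDLaws.
Variables (K : fieldType) (A B : uctdAlgType K).
Notation T := (tensor A B).
Notation tp := (@tens_prec K A B).
Notation td := (@tens_dot K A B).
Notation t1 := (tens_one A B).
Implicit Types (x y z : T) (a : A) (b : B).

Let tpDl := bilinDl (@tens_prec_bilin K A B).
Let tpDr := bilinDr (@tens_prec_bilin K A B).
Let tpZl := bilinZl (@tens_prec_bilin K A B).
Let tpZr := bilinZr (@tens_prec_bilin K A B).
Let tdDl := bilinDl (@tens_dot_bilin K A B).
Let tdDr := bilinDr (@tens_dot_bilin K A B).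
Let tdZl := bilinZl (@tens_dot_bilin K A B).
Let tdZr := bilinZr (@tens_dot_bilin K A B).

Lemma tens_augD x y : tens_aug (x + y) = tens_aug x + tens_aug y.
Proof. exact: (linhD (@tens_aug_linear K A B)). Qed.
Lemma tens_augZ k x : tens_aug (k *: x) = k * tens_aug x.
Proof. exact: (linhZ (@tens_aug_linear K A B)). Qed.

Lemma tens_aug_scalar : scalar (@tens_aug K A B).
Proof. by move=> k x y /=; rewrite tens_augD tens_augZ. Qed.

Lemma tens_aug_one : tens_aug t1 = 1.
Proof. by rewrite tens_augE !aug_one mulr1. Qed.

Lemma tens_aug_prec x y : tens_aug (tp x y) = 0.
Proof.
elim/tens_ind: x => [a b|x x' hx hx']; last by rewrite tpDl tens_augD hx hx' addr0.
elim/tens_ind: y => [a' b'|y y' hy hy']; last by rewrite tpDr tens_augD hy hy' addr0.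
rewrite tens_precE tens_augD tens_augZ !tens_augE !aug_prec.
by rewrite mul0r !mulr0 addr0.
Qed.

Lemma tens_aug_dot x y : tens_aug (td x y) = 0.
Proof.
elim/tens_ind: x => [a b|x x' hx hx']; last by rewrite tdDl tens_augD hx hx' addr0.
elim/tens_ind: y => [a' b'|y y' hy hy']; last by rewrite tdDr tens_augD hy hy' addr0.
rewrite tens_dotE tens_augD tens_augZ !tens_augE !aug_dot.
by rewrite mul0r !mulr0 addr0.
Qed.

Lemma tens_prec1x x : tp t1 x = 0.
Proof.
elim/tens_ind: x => [a b|x y hx hy]; last by rewrite tpDr hx hy addr0.
by rewrite tens_precE !prec1x tens0l tens0r scaler0 addr0.
Qed.

Lemma tens_dot1x x : td t1 x = 0.
Proof.
elim/tens_ind: x => [a b|x y hx hy]; last by rewrite tdDr hx hy addr0.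
by rewrite tens_dotE !dot1x tens0l tens0r scaler0 addr0.
Qed.

Lemma tens_precx1 x : tp x t1 = x - tens_aug x *: t1.
Proof.
elim/tens_ind: x => [a b|x y hx hy].
  rewrite tens_precE tens_augE !precx1 starx1 aug_one mulr1.
  rewrite (bilinBl (@tens_bilin K A B)) (bilinBr (@tens_bilin K A B)).
  by rewrite tensZl tensZr scalerBr addrA subrK scalerA.
by rewrite tpDl hx hy tens_augD scalerDl opprD addrACA.
Qed.

Lemma tens_dotC x y : td x y = td y x.
Proof.
elim/tens_ind: x => [a b|x x' hx hx']; last by rewrite tdDl tdDr hx hx'.
elim/tens_ind: y => [a' b'|y y' hy hy']; last by rewrite tdDl tdDr hy hy'.
by rewrite !tens_dotE dotC starC [dot b b']dotC mulrC.
Qed.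

Definition tens_star x y :=
  tp x y + tp y x + td x y + (tens_aug x * tens_aug y) *: t1.

Lemma tens_starE a b a' b' :
  tens_star (a ⊗ b) (a' ⊗ b') = star a a' ⊗ star b b'.
Proof.
have AC (p q d e1 e2 e3 : T) :
    p + e1 + (q + e2) + (d + e3) = p + q + d + (e1 + e2 + e3).
  by rewrite [p + e1 + (q + e2)]addrACA [LHS]addrACA.
rewrite /tens_star !tens_precE tens_dotE !tens_augE [aug a' * aug a]mulrC.
rewrite [star b' b]starC AC [in RHS](starE a a') [in RHS]tensDl tensZl.
rewrite [X in _ = _ + _ *: (_ ⊗ X)]starE !tensDr tensZr !tensDl !scalerDr.
by rewrite [in RHS]scalerA mulrACA [in RHS]addrA.
Qed.

Let AC4 (p p' q q' d d' w w' : T) :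
  p + p' + (q + q') + (d + d') + (w + w') = p + q + d + w + (p' + q' + d' + w').
Proof.
by rewrite [p + p' + _]addrACA [X in X + _ = _]addrACA [LHS]addrACA.
Qed.

Let tsDl x x' y : tens_star (x + x') y = tens_star x y + tens_star x' y.
Proof.
rewrite /tens_star tpDl tpDr tdDl tens_augD mulrDl scalerDl.
exact: AC4.
Qed.
Let tsDr x y y' : tens_star x (y + y') = tens_star x y + tens_star x y'.
Proof.
rewrite /tens_star tpDl tpDr tdDr tens_augD mulrDr scalerDl.
exact: AC4.
Qed.

Lemma tens_prec_prec x y z : tp (tp x y) z = tp x (tens_star y z).
Proof.
elim/tens_ind: x => [a b|x x' hx hx']; last by rewrite !tpDl hx hx'.
elim/tens_ind: y => [a' b'|y y' hy hy']; last by rewrite tpDr tpDl tsDl tpDr hy hy'.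
elim/tens_ind: z => [a2 b2|z z' hz hz']; last by rewrite tpDr tsDr tpDr hz hz'.
rewrite tens_starE !tens_precE tpDl tpZl !tens_precE aug_prec prec_prec starA.
rewrite mul0r scale0r addr0 prec1x tens0l add0r aug_one mul1r prec_prec.
by rewrite aug_star scalerA mulrA.
Qed.

Lemma tens_dot_prec x y z : tp (td x y) z = td x (tp y z).
Proof.
elim/tens_ind: x => [a b|x x' hx hx']; last by rewrite !tdDl tpDl hx hx'.
elim/tens_ind: y => [a' b'|y y' hy hy']; last by rewrite tdDr !tpDl tdDr hy hy'.
elim/tens_ind: z => [a2 b2|z z' hz hz']; last by rewrite !tpDr tdDr hz hz'.
rewrite tens_precE !tens_dotE tpDl tpZl tdDr tdZr !tens_precE !tens_dotE.
rewrite aug_prec aug_dot dot_prec starA mulr0 mul0r !scale0r !addr0.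
rewrite prec1x dotx1 !tens0l !add0r aug_one mul1r mulr1 dot_prec.
by rewrite !scalerA; congr (_ + _ *: _); rewrite -mulrA mulrC -mulrA [aug a2 * _]mulrC.
Qed.

Lemma tens_dotA x y z : td (td x y) z = td x (td y z).
Proof.
elim/tens_ind: x => [a b|x x' hx hx']; last by rewrite !tdDl hx hx'.
elim/tens_ind: y => [a' b'|y y' hy hy']; last by rewrite tdDr !tdDl tdDr hy hy'.
elim/tens_ind: z => [a2 b2|z z' hz hz']; last by rewrite !tdDr hz hz'.
rewrite !tens_dotE tdDl tdZl tdDr tdZr !tens_dotE.
rewrite !aug_dot dotA starA mulr0 mul0r !scale0r !addr0.
rewrite dot1x dotx1 !tens0l !add0r aug_one mul1r mulr1 dotA.
by rewrite !scalerA; congr (_ + _ *: _); rewrite -mulrA mulrC -mulrA [aug a2 * _]mulrC.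
Qed.

Let tens_laws : ctd_laws (fun x => tens_aug x = 0) tp td.
Proof.
split=> [x y _ _|x y z hx hy hz|x y z _ _ _|x y z _ _ _].
- exact: tens_dotC.
- by rewrite tens_prec_prec /tens_star hy mul0r scale0r addr0.
- exact: tens_dot_prec.
- exact: tens_dotA.
Qed.

HB.instance Definition _ := isUnitalCTD.Build K (tensor A B)
  tens_aug_scalar tens_aug_one (@tens_prec_bilin K A B) (@tens_dot_bilin K A B)
  (fun x y _ _ => tens_aug_prec x y) (fun x y _ _ => tens_aug_dot x y) tens_laws
  (fun x _ => tens_dot1x x)
  (fun x _ => etrans (tens_dotC x t1) (tens_dot1x x))
  (fun x _ => tens_prec1x x)
  (fun x hx => etrans (tens_precx1 x)
     (etrans (congr1 (fun k => x - k *: t1) hx)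
       (etrans (congr1 (fun y => x - y) (scale0r t1)) (subr0 x))))
  (tens_prec1x t1) (tens_dot1x t1).

End TensorUCTDLaws.

Section TensorUCTDMorphisms.
Variable K : fieldType.

Lemma tmap_uctd_morphism (A A' B B' : uctdAlgType K) (f : A -> A') (g : B -> B') :
  uctd_morphism f -> uctd_morphism g -> uctd_morphism (tmap f g).
Proof.
move=> fm gm; have lf := uctdm_linear fm; have lg := uctdm_linear gm.
have lfg := tmap_linear lf lg.
have E u v : tmap f g (u ⊗ v) = f u ⊗ g v by exact: tmap_tens.
have auE t : aug (tmap f g t) = aug t.
  elim/tens_ind: t => [a b|x y hx hy]; last by rewrite (linhD lfg) !augD hx hy.
  by rewrite E [LHS]tens_augE [RHS]tens_augE (uctdm_aug fm) (uctdm_aug gm).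
apply: mk_uctd_morphism => //.
- by rewrite E (uctdm_one fm) (uctdm_one gm).
- move=> x y.
  elim/tens_ind: x => [a b|x x' hx hx'];
    last by rewrite precDl !(linhD lfg) precDl hx hx'.
  elim/tens_ind: y => [a' b'|y y' hy hy'];
    last by rewrite precDr !(linhD lfg) precDr hy hy'.
  rewrite [prec (_ ⊗ _) _]tens_precE (linhD lfg) (linhZ lfg) !E.
  rewrite [RHS]tens_precE (uctdm_precT fm) (uctdm_precT gm) (uctdm_star gm).
  by rewrite (uctdm_one fm) !(uctdm_aug fm).
move=> x y.
elim/tens_ind: x => [a b|x x' hx hx'];
  last by rewrite dotDl !(linhD lfg) dotDl hx hx'.
elim/tens_ind: y => [a' b'|y y' hy hy'];
  last by rewrite dotDr !(linhD lfg) dotDr hy hy'.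
rewrite [dot (_ ⊗ _) _]tens_dotE (linhD lfg) (linhZ lfg) !E.
rewrite [RHS]tens_dotE (uctdm_dotT fm) (uctdm_dotT gm) (uctdm_star gm).
by rewrite (uctdm_one fm) !(uctdm_aug fm).
Qed.

Lemma id_uctd_morphism (A : uctdAlgType K) : uctd_morphism (@id A).
Proof. by split. Qed.

Lemma tens_star_tens (A B : uctdAlgType K) (a a' : A) (b b' : B) :
  star (a ⊗ b) (a' ⊗ b') = star a a' ⊗ star b b'.
Proof. by rewrite starE; apply: tens_starE. Qed.

Lemma tassoc_uctd_morphism (A B C : uctdAlgType K) :
  uctd_morphism (@tassoc K A B C).
Proof.
have lt := @tassoc_linear K A B C.
have E (a : A) (b : B) (c : C) : tassoc ((a ⊗ b) ⊗ c) = a ⊗ (b ⊗ c).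
  exact: tassoc_tens.
have ind (P : tensor (tensor A B) C -> Prop) :
    (forall a b c, P ((a ⊗ b) ⊗ c)) -> (forall x y, P x -> P y -> P (x + y)) ->
    forall x, P x.
  move=> Pt PD; elim/tens_ind => // t c; elim/tens_ind: t => // x y hx hy.
  by rewrite tensDl; apply: PD.
apply: mk_uctd_morphism => //.
- exact: E.
- elim/ind => [a b c|x y hx hy]; last by rewrite (linhD lt) !augD hx hy.
  rewrite E [LHS]tens_augE [aug (b ⊗ c)]tens_augE [RHS]tens_augE.
  by rewrite [aug (a ⊗ b)]tens_augE mulrA.
- move=> x y.
  elim/ind: x => [a b c|x x' hx hx'];
    last by rewrite precDl !(linhD lt) precDl hx hx'.
  elim/ind: y => [a' b' c'|y y' hy hy'];
    last by rewrite precDr !(linhD lt) precDr hy hy'.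
  rewrite !E [LHS](congr1 _ (tens_precE _ _ _ _)).
  rewrite [prec (a ⊗ b) _]tens_precE [aug (a ⊗ b)]tens_augE.
  rewrite [aug (a' ⊗ b')]tens_augE [uone in uone ⊗ prec c c']/(uone ⊗ uone).
  rewrite tensDl tensZl !(linhD lt, linhZ lt) !E.
  rewrite [RHS]tens_precE [prec (b ⊗ c) _]tens_precE tens_star_tens.
  by rewrite tensDr tensZr scalerDr scalerA addrA mulrACA.
move=> x y.
elim/ind: x => [a b c|x x' hx hx'];
  last by rewrite dotDl !(linhD lt) dotDl hx hx'.
elim/ind: y => [a' b' c'|y y' hy hy'];
  last by rewrite dotDr !(linhD lt) dotDr hy hy'.
rewrite !E [LHS](congr1 _ (tens_dotE _ _ _ _)).
rewrite [dot (a ⊗ b) _]tens_dotE [aug (a ⊗ b)]tens_augE.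
rewrite [aug (a' ⊗ b')]tens_augE [uone in uone ⊗ dot c c']/(uone ⊗ uone).
rewrite tensDl tensZl !(linhD lt, linhZ lt) !E.
rewrite [RHS]tens_dotE [dot (b ⊗ c) _]tens_dotE tens_star_tens.
by rewrite tensDr tensZr scalerDr scalerA addrA mulrACA.
Qed.

End TensorUCTDMorphisms.

Section TensorUCTDPrimitives.
Variables (K : fieldType) (A : uctdAlgType K).

Lemma tens_prim_dot (x y : A) : aug x = 0 -> aug y = 0 ->
  dot (x ⊗ uone + uone ⊗ x) (y ⊗ uone + uone ⊗ y) =
  dot x y ⊗ uone + uone ⊗ dot x y :> tensor A A.
Proof.
move=> ax ay.
have E (a b c d : A) : dot (a ⊗ b) (c ⊗ d) =
    dot a c ⊗ star b d + (aug a * aug c) *: (uone ⊗ dot b d).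
  exact: tens_dotE.
rewrite dotDl !dotDr !E ax ay !dotx1 !dot1x star1x aug_one.
by rewrite !(mul0r, mulr0, tens0l, scale0r) mulr1 scale1r !(add0r, addr0).
Qed.

Lemma epsl_bilin : bilin (fun a b : A => aug a *: b).
Proof.
split=> u; apply: mk_linear => [v w|k v].
- by rewrite augD scalerDl.
- by rewrite augZ scalerA.
- by rewrite scalerDr.
- by rewrite !scalerA mulrC.
Qed.

Lemma epsl_morphism :
  uctd_morphism (tlift (fun a b : A => aug a *: b) : tensor A A -> A).
Proof.
have le := tlift_linear epsl_bilin.
have E (a b : A) : tlift (fun a b : A => aug a *: b) (a ⊗ b) = aug a *: b.
  exact: (tlift_tens epsl_bilin).
apply: mk_uctd_morphism => //.
- by rewrite E aug_one scale1r.
- elim/tens_ind => [a b|x y hx hy]; last by rewrite (linhD le) !augD hx hy.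
  by rewrite E augZ [RHS]tens_augE.
- move=> x y.
  elim/tens_ind: x => [a b|x x' hx hx'];
    last by rewrite precDl !(linhD le) precDl hx hx'.
  elim/tens_ind: y => [a' b'|y y' hy hy'];
    last by rewrite precDr !(linhD le) precDr hy hy'.
  rewrite [prec (_ ⊗ _) _]tens_precE (linhD le) (linhZ le) !E aug_prec aug_one.
  by rewrite scale0r add0r scale1r precZl precZr scalerA.
move=> x y.
elim/tens_ind: x => [a b|x x' hx hx'];
  last by rewrite dotDl !(linhD le) dotDl hx hx'.
elim/tens_ind: y => [a' b'|y y' hy hy'];
  last by rewrite dotDr !(linhD le) dotDr hy hy'.
rewrite [dot (_ ⊗ _) _]tens_dotE (linhD le) (linhZ le) !E aug_dot aug_one.
by rewrite scale0r add0r scale1r dotZl dotZr scalerA.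
Qed.

Lemma epsr_bilin : bilin (fun a b : A => aug b *: a).
Proof. exact: bilin_flip epsl_bilin. Qed.

Lemma epsr_morphism :
  uctd_morphism (tlift (fun a b : A => aug b *: a) : tensor A A -> A).
Proof.
have le := tlift_linear epsr_bilin.
have E (a b : A) : tlift (fun a b : A => aug b *: a) (a ⊗ b) = aug b *: a.
  exact: (tlift_tens epsr_bilin).
apply: mk_uctd_morphism => //.
- by rewrite E aug_one scale1r.
- elim/tens_ind => [a b|x y hx hy]; last by rewrite (linhD le) !augD hx hy.
  by rewrite E augZ [RHS]tens_augE mulrC.
- move=> x y.
  elim/tens_ind: x => [a b|x x' hx hx'];
    last by rewrite precDl !(linhD le) precDl hx hx'.
  elim/tens_ind: y => [a' b'|y y' hy hy'];
    last by rewrite precDr !(linhD le) precDr hy hy'.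
  rewrite [prec (_ ⊗ _) _]tens_precE (linhD le) (linhZ le) !E aug_prec aug_star.
  by rewrite scale0r scaler0 addr0 precZl precZr scalerA.
move=> x y.
elim/tens_ind: x => [a b|x x' hx hx'];
  last by rewrite dotDl !(linhD le) dotDl hx hx'.
elim/tens_ind: y => [a' b'|y y' hy hy'];
  last by rewrite dotDr !(linhD le) dotDr hy hy'.
rewrite [dot (_ ⊗ _) _]tens_dotE (linhD le) (linhZ le) !E aug_dot aug_star.
by rewrite scale0r scaler0 addr0 dotZl dotZr scalerA.
Qed.

Section GenericCoproduct.
Variable c : A -> tensor A A.
Hypothesis cm : uctd_morphism c.
Let lc := uctdm_linear cm.
Let li : linear (@id A). Proof. by []. Qed.

Lemma prim_coassoc x : c x = x ⊗ uone + uone ⊗ x ->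
  tassoc (tmap c id (c x)) = tmap id c (c x).
Proof.
move=> cx; have lt := @tassoc_linear K A A A.
rewrite cx !(linhD (tmap_linear lc li), linhD (tmap_linear li lc)).
rewrite !tmap_tens // (uctdm_one cm) cx tensDl tensDr !(linhD lt).
by rewrite !tassoc_tens addrA.
Qed.

Lemma prim_counitl x : aug x = 0 -> c x = x ⊗ uone + uone ⊗ x ->
  tlift (fun a b : A => aug a *: b) (c x) = x.
Proof.
move=> ax ->; rewrite (linhD (tlift_linear epsl_bilin)).
by rewrite !(tlift_tens epsl_bilin) ax aug_one scale0r scale1r add0r.
Qed.

Lemma prim_counitr x : aug x = 0 -> c x = x ⊗ uone + uone ⊗ x ->
  tlift (fun a b : A => aug b *: a) (c x) = x.
Proof.
move=> ax ->; rewrite (linhD (tlift_linear epsr_bilin)).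
by rewrite !(tlift_tens epsr_bilin) ax aug_one scale0r scale1r addr0.
Qed.

End GenericCoproduct.
End TensorUCTDPrimitives.

HB.mixin Record isCoalgebra (K : fieldType) C of GRing.Lmodule K C := {
  comul : C -> tensor C C;
  counit : C -> K;
  comul_linear : linear comul;
  counit_linear : scalar counit;
  comulA : forall x, tassoc (tmap comul id (comul x)) = tmap id comul (comul x);
  counitl : forall x, tlift (fun a b => counit a *: b) (comul x) = x;
  counitr : forall x, tlift (fun a b => counit b *: a) (comul x) = x
}.

#[short(type="coalgType")]
HB.structure Definition Coalgebra (K : fieldType) :=
  {C of GRing.Lmodule K C & isCoalgebra K C}.

HB.mixin Record isCTDBialgebra (K : fieldType) H
    of UnitalCTD K H & Coalgebra K H := {
  counit_aug : forall x : H, counit x = aug x;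
  comul_uctd_morphism : uctd_morphism (comul : H -> tensor H H)
}.

#[short(type="ctdBialgType")]
HB.structure Definition CTDBialgebra (K : fieldType) :=
  {H of UnitalCTD K H & Coalgebra K H & isCTDBialgebra K H}.

Record coalg_morphism (K : fieldType) (C D : coalgType K) (f : C -> D) : Prop :=
  CoalgMorphism {
  coalgm_linear : linear f;
  coalgm_comul : forall x, comul (f x) = tmap f f (comul x);
  coalgm_counit : forall x, counit (f x) = counit x
}.

Definition coalg_isomorphic (K : fieldType) (C D : coalgType K) : Prop :=
  exists f : C -> D, coalg_morphism f /\ bijective f.

Definition ctd_bialg_isomorphic (K : fieldType) (H L : ctdBialgType K) : Prop :=
  exists f : H -> L, [/\ uctd_morphism f, coalg_morphism f & bijective f].

HB.mixin Record isNonUnitalComAlgebra (K : fieldType) R of GRing.Lmodule K R := {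
  nmul : R -> R -> R;
  nmul_bilin : bilin nmul;
  nmulC : commutative nmul;
  nmulA : associative nmul
}.

#[short(type="nuComAlgType")]
HB.structure Definition NonUnitalComAlgebra (K : fieldType) :=
  {R of GRing.Lmodule K R & isNonUnitalComAlgebra K R}.

Definition reduced_comul (K : fieldType) (H : ctdBialgType K) (x : H) :
    tensor H H :=
  comul x - x ⊗ uone - uone ⊗ x.

Definition primitive (K : fieldType) (H : ctdBialgType K) : {pred H} :=
  fun x => reduced_comul x == 0.
Arguments primitive {K} H _.

Record Prim (K : fieldType) (H : ctdBialgType K) : Type :=
  MkPrim { prim_val : H; prim_valP : prim_val \in primitive H }.

HB.instance Definition _ (K : fieldType) (H : ctdBialgType K) :=
  [isSub for @prim_val K H].
HB.instance Definition _ (K : fieldType) (H : ctdBialgType K) :=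
  [Choice of Prim H by <:].

Section PrimTheory.
Variables (K : fieldType) (H : ctdBialgType K).
Implicit Types x y : H.

Lemma reduced_comul_linear : linear (@reduced_comul K H).
Proof.
apply: mk_linear => [x y|k x]; rewrite /reduced_comul.
  rewrite (linhD comul_linear) tensDl tensDr.
  by rewrite !opprD [X in X + _ = _]addrACA [LHS]addrACA.
by rewrite (linhZ comul_linear) tensZl tensZr !scalerBr.
Qed.

Lemma primitiveP x : reflect (comul x = x ⊗ uone + uone ⊗ x) (x \in primitive H).
Proof.
rewrite unfold_in /reduced_comul -addrA -opprD subr_eq0; exact: eqP.
Qed.

Lemma primitive_aug x : x \in primitive H -> aug x = 0.
Proof.
move=> /primitiveP hx; have := @counitl K H x; rewrite hx.
have bf : bilin (fun a b : H => counit a *: b).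
  split=> u; apply: mk_linear => [v w|k v]; rewrite !counit_aug.
  - by rewrite augD scalerDl.
  - by rewrite augZ scalerA.
  - by rewrite scalerDr.
  - by rewrite !scalerA mulrC.
rewrite (linhD (tlift_linear bf)) !(tlift_tens bf) !counit_aug aug_one scale1r.
move/(congr1 (fun y => y - x)); rewrite addrK subrr => /(congr1 (@aug K H)).
by rewrite augZ aug_one mulr1 aug0.
Qed.

Lemma primitive_submod : submod_closed (primitive H).
Proof.
split; first by rewrite unfold_in (linh0 reduced_comul_linear).
move=> k x y; rewrite !unfold_in => /eqP hx /eqP hy.
by rewrite (reduced_comul_linear k x y) /= hx hy scaler0 addr0.
Qed.

HB.instance Definition _ := GRing.isSubmodClosed.Build K H (primitive H)
  primitive_submod.
HB.instance Definition _ := [SubChoice_isSubLmodule of Prim H by <:].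

Lemma primitive_dot x y :
  x \in primitive H -> y \in primitive H -> dot x y \in primitive H.
Proof.
move=> px py; have ax := primitive_aug px; have ay := primitive_aug py.
move/primitiveP: px => px; move/primitiveP: py => py; apply/primitiveP.
by rewrite (uctdm_dot comul_uctd_morphism) // px py tens_prim_dot.
Qed.

Definition prim_mul (x y : Prim H) : Prim H :=
  MkPrim (primitive_dot (prim_valP x) (prim_valP y)).

Lemma prim_mul_bilin : bilin prim_mul.
Proof.
by split=> z; apply: mk_linear => [x y|k x]; apply: val_inj => /=;
  rewrite ?(dotDl, dotDr, dotZl, dotZr).
Qed.
Lemma prim_mulC : commutative prim_mul.
Proof. by move=> x y; apply: val_inj; apply: dotC. Qed.
Lemma prim_mulA : associative prim_mul.
Proof. by move=> x y z; apply: val_inj; rewrite /= dotA. Qed.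

HB.instance Definition _ := isNonUnitalComAlgebra.Build K (Prim H)
  prim_mul_bilin prim_mulC prim_mulA.

End PrimTheory.

(* The image of [P ⊗ Q] in [U ⊗ V], for subspaces [P] of [U] and [Q] of [V]. *)
Definition tens_subspace (K : fieldType) (U V : lmodType K) (P : U -> Prop)
    (Q : V -> Prop) (t : tensor U V) : Prop :=
  exists (n : nat) (u : 'I_n -> U) (v : 'I_n -> V),
    [/\ forall i, P (u i), forall i, Q (v i) & t = \sum_(i < n) u i ⊗ v i].

Fixpoint filtr (K : fieldType) (H : ctdBialgType K) (r : nat) : H -> Prop :=
  match r with
  | 0 => fun x => exists a : K, x = a *: uone
  | r'.+1 => fun x => tens_subspace (filtr r') (filtr r') (reduced_comul x)
  end.

Definition connected (K : fieldType) (H : ctdBialgType K) : Prop :=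
  forall x : H, exists r, filtr r x.

Section Unitization.
Variables (K : fieldType) (A : ctdAlgType K).

Definition unitization : Type := (K^o * A)%type.

HB.instance Definition _ := GRing.Lmodule.on unitization.

Implicit Types x y z : unitization.

Definition unit_one : unitization := (1, 0).
Definition unit_aug x : K := x.1.
(* The term [y.1 *: x.2] is the rule [x ≺ 1 = x] on [A]. *)
Definition unit_prec x y : unitization := (0, (y.1 : K) *: x.2 + nprec x.2 y.2).
Definition unit_dot x y : unitization := (0, ndot x.2 y.2).

Let prec0 := (bilin0l (@nprec_bilin K A), bilin0r (@nprec_bilin K A)).
Let dot0 := (bilin0l (@ndot_bilin K A), bilin0r (@ndot_bilin K A)).

Let pairD x y : x + y = (x.1 + y.1, x.2 + y.2) :> unitization.
Proof. by []. Qed.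
Let pairZ k x : k *: x = (k * x.1, k *: x.2) :> unitization.
Proof. by []. Qed.

Lemma unit_aug_linear : scalar unit_aug.
Proof. by []. Qed.

Lemma unit_prec_bilin : bilin unit_prec.
Proof.
split=> z; apply: mk_linear => [x y|k x]; rewrite !(pairD, pairZ) /unit_prec /=;
  congr (_, _); rewrite ?addr0 ?mulr0 //.
- by rewrite scalerDr (bilinDl (@nprec_bilin K A)) addrACA.
- by rewrite (bilinZl (@nprec_bilin K A)) scalerDr !scalerA mulrC.
- by rewrite scalerDl (bilinDr (@nprec_bilin K A)) addrACA.
- by rewrite (bilinZr (@nprec_bilin K A)) scalerDr !scalerA.
Qed.

Lemma unit_dot_bilin : bilin unit_dot.
Proof.
split=> z; apply: mk_linear => [x y|k x]; rewrite !(pairD, pairZ) /unit_dot /=;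
  congr (_, _); rewrite ?addr0 ?mulr0 //.
- exact: (bilinDl (@ndot_bilin K A)).
- exact: (bilinZl (@ndot_bilin K A)).
- exact: (bilinDr (@ndot_bilin K A)).
- exact: (bilinZr (@ndot_bilin K A)).
Qed.

Lemma unit_laws : ctd_laws (fun x => unit_aug x = 0) unit_prec unit_dot.
Proof.
rewrite /unit_aug /unit_prec /unit_dot.
split=> [[a x] [b y] _ _|[a x] [b y] [c z] _ /= hb hc|[a x] [b y] [c z] _ _ /= hc
  |[a x] [b y] [c z] _ _ _] /=.
- by rewrite (ctd_dotC nctd_laws).
- rewrite hb hc !addr0 !scale0r !add0r.
  by rewrite (ctd_prec_prec nctd_laws).
- by rewrite hc !scale0r !add0r (ctd_dot_prec nctd_laws).
- by rewrite (ctd_dotA nctd_laws).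
Qed.

Lemma unit_dot1x x : unit_dot unit_one x = 0.
Proof. by rewrite /unit_dot /= dot0. Qed.
Lemma unit_dotx1 x : unit_dot x unit_one = 0.
Proof. by rewrite /unit_dot /= dot0. Qed.
Lemma unit_prec1x x : unit_prec unit_one x = 0.
Proof. by rewrite /unit_prec /= prec0 scaler0 addr0. Qed.
Lemma unit_precx1 x : unit_aug x = 0 -> unit_prec x unit_one = x.
Proof.
by case: x => a x; rewrite /unit_aug /unit_prec /= prec0 scale1r addr0 => ->.
Qed.

HB.instance Definition _ := isUnitalCTD.Build K unitization
  unit_aug_linear (erefl : unit_aug unit_one = 1) unit_prec_bilin unit_dot_bilin
  (fun x y _ _ => erefl) (fun x y _ _ => erefl) unit_laws
  (fun x _ => unit_dot1x x) (fun x _ => unit_dotx1 x) (fun x _ => unit_prec1x x)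
  unit_precx1 (unit_prec1x unit_one) (unit_dot1x unit_one).

End Unitization.

(* The augmentation ideal of the universal enveloping CTD-algebra [UCTD R] is the
   CTD-algebra generated by the vector space [R] ([UR_lin]), subject to the
   relations identifying the product of [R] with the dot product ([UR_mul]). The
   universal property of [UCTD R] is given by [UCTD_lift_gen],
   [UCTD_lift_morphism] and [UCTD_morphism_ext]. *)

Variant ctd_op : Type := PrecOp | DotOp.

Section UCTDRel.
Variables (K : fieldType) (R : nuComAlgType K).
Notation E := (expr K R ctd_op).
Local Notation "s ≺ t" := (EOp PrecOp s t) (at level 40).
Local Notation "s • t" := (EOp DotOp s t) (at level 40).

Inductive UCTD_rel : E -> E -> Prop :=
  | UR_lin a (r s : R) :
      UCTD_rel (EGen (a *: r + s)) (EAdd (EScale a (EGen r)) (EGen s))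
  | UR_mul (r s : R) : UCTD_rel (EGen (nmul r s)) (EGen r • EGen s)
  | UR_dotC s t : UCTD_rel (s • t) (t • s)
  | UR_prec_prec s t u :
      UCTD_rel ((s ≺ t) ≺ u) (s ≺ EAdd (EAdd (t ≺ u) (u ≺ t)) (t • u))
  | UR_dot_prec s t u : UCTD_rel ((s • t) ≺ u) (s • (t ≺ u))
  | UR_dotA s t u : UCTD_rel ((s • t) • u) (s • (t • u)).

End UCTDRel.

Definition UCTD_bar (K : fieldType) (R : nuComAlgType K) : Type :=
  presented (@UCTD_rel K R).

HB.instance Definition _ (K : fieldType) (R : nuComAlgType K) :=
  GRing.Lmodule.on (UCTD_bar R).

Section UCTDBar.
Variables (K : fieldType) (R : nuComAlgType K).

Definition UCTD_prec : UCTD_bar R -> UCTD_bar R -> UCTD_bar R :=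
  @pop _ _ _ (@UCTD_rel K R) PrecOp.
Definition UCTD_dot : UCTD_bar R -> UCTD_bar R -> UCTD_bar R :=
  @pop _ _ _ (@UCTD_rel K R) DotOp.

Lemma UCTD_laws : ctd_laws (fun=> True) UCTD_prec UCTD_dot.
Proof.
split=> [x y _ _|x y z _ _ _|x y z _ _ _|x y z _ _ _];
  rewrite /UCTD_prec /UCTD_dot.
- case: (pclass_ex x) (pclass_ex y) => s -> [t ->]; rewrite -!pclass_op.
  exact/pclassP/EC_rel/UR_dotC.
- case: (pclass_ex x) (pclass_ex y) (pclass_ex z) => s -> [t ->] [u ->].
  have /pclassP := EC_rel (UR_prec_prec s t u).
  by rewrite !(pclass_op, pclassD).
- case: (pclass_ex x) (pclass_ex y) (pclass_ex z) => s -> [t ->] [u ->].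
  rewrite -!pclass_op; exact/pclassP/EC_rel/UR_dot_prec.
- case: (pclass_ex x) (pclass_ex y) (pclass_ex z) => s -> [t ->] [u ->].
  rewrite -!pclass_op; exact/pclassP/EC_rel/UR_dotA.
Qed.

HB.instance Definition _ := isCTDAlgebra.Build K (UCTD_bar R)
  (@pop_bilin _ _ _ (@UCTD_rel K R) PrecOp)
  (@pop_bilin _ _ _ (@UCTD_rel K R) DotOp) UCTD_laws.

End UCTDBar.

Definition UCTD (K : fieldType) (R : nuComAlgType K) : Type :=
  unitization (UCTD_bar R).

HB.instance Definition _ (K : fieldType) (R : nuComAlgType K) :=
  UnitalCTD.on (UCTD R).

Section UCTDTheory.
Variables (K : fieldType) (R : nuComAlgType K).

Definition UCTD_gen (r : R) : UCTD R := (0, pgen (@UCTD_rel K R) r).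

Lemma UCTD_gen_linear : linear UCTD_gen.
Proof.
move=> a r s; rewrite /UCTD_gen /=; congr (_, _); first by rewrite /= scaler0 addr0.
rewrite /= -[a *: pgen _ r]pclassZ -[RHS]pclassD.
exact/pclassP/EC_rel/UR_lin.
Qed.

Lemma aug_UCTD_gen r : aug (UCTD_gen r) = 0.
Proof. by []. Qed.

Lemma UCTD_gen_mul r s : UCTD_gen (nmul r s) = dot (UCTD_gen r) (UCTD_gen s).
Proof.
congr (_, _); rewrite /= -[RHS]pclass_op; exact/pclassP/EC_rel/UR_mul.
Qed.

Lemma UCTD_ind (P : UCTD R -> Prop) :
  P uone -> (forall r, P (UCTD_gen r)) ->
  (forall x y, P x -> P y -> P (x + y)) -> (forall a x, P x -> P (a *: x)) ->
  (forall x y, aug x = 0 -> aug y = 0 -> P x -> P y -> P (prec x y)) ->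
  (forall x y, aug x = 0 -> aug y = 0 -> P x -> P y -> P (dot x y)) ->
  forall x, P x.
Proof.
move=> P1 Pg PD PZ Pp Pd; elim/uctd_ind => // -[a x] ax; have {ax a}-> : a = 0 := ax.
elim/presented_ind: x => [r||x y hx hy|k x hx|[] x y hx hy].
- exact: Pg.
- have -> : (0, 0) = 0 *: uone :> UCTD R by rewrite scale0r.
  exact: PZ.
- have -> : (0, x + y) = (0, x) + (0, y) :> UCTD R by congr (_, _); rewrite /= addr0.
  exact: PD.
- have -> : (0, k *: x) = k *: (0, x) :> UCTD R by congr (_, _); rewrite /= scaler0.
  exact: PZ.
- have -> : (0, pop PrecOp x y) = prec ((0, x) : UCTD R) ((0, y) : UCTD R).
    by congr (_, _); rewrite /= scale0r add0r.
  exact: Pp.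
- exact: (Pd (0, x) (0, y)).
Qed.

Lemma UCTD_morphism_ext (A : uctdAlgType K) (f g : UCTD R -> A) :
  uctd_morphism f -> uctd_morphism g ->
  (forall r, f (UCTD_gen r) = g (UCTD_gen r)) -> f =1 g.
Proof.
move=> fm gm fg; have lf := uctdm_linear fm; have lg := uctdm_linear gm.
elim/UCTD_ind => // [|x y hx hy|a x hx|x y ax ay hx hy|x y ax ay hx hy].
- by rewrite (uctdm_one fm) (uctdm_one gm).
- by rewrite (linhD lf) (linhD lg) hx hy.
- by rewrite (linhZ lf) (linhZ lg) hx.
- by rewrite (uctdm_prec fm) // (uctdm_prec gm) // hx hy.
- by rewrite (uctdm_dot fm) // (uctdm_dot gm) // hx hy.
Qed.

Section UCTDLift.
Variables (A : uctdAlgType K) (f : R -> A).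

Definition ctd_op_of (o : ctd_op) : A -> A -> A :=
  match o with PrecOp => prec | DotOp => dot end.

Definition UCTD_lift (x : UCTD R) : A :=
  (x.1 : K) *: uone + plift f ctd_op_of x.2.

Hypotheses (lf : linear f) (f_aug : forall r, aug (f r) = 0).
Hypothesis f_mul : forall r s, f (nmul r s) = dot (f r) (f s).

Let op_bilin o : bilin (ctd_op_of o).
Proof. by case: o; [apply: prec_bilin | apply: dot_bilin]. Qed.

Let aug_eval s : aug (evalE f ctd_op_of s) = 0.
Proof.
elim: s => [r||s hs t ht|a s hs|[] s hs t ht] /=.
- exact: f_aug.
- exact: aug0.
- by rewrite augD hs ht addr0.
- by rewrite augZ hs mulr0.
- exact: aug_prec.
- exact: aug_dot.
Qed.

Let rel_ok s t : UCTD_rel s t -> evalE f ctd_op_of s = evalE f ctd_op_of t.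
Proof.
case=> * /=.
- by rewrite lf.
- exact: f_mul.
- exact: dotC.
- by rewrite prec_prec star_bar.
- exact: dot_prec.
- exact: dotA.
Qed.

Lemma UCTD_lift_gen r : UCTD_lift (UCTD_gen r) = f r.
Proof. by rewrite /UCTD_lift /= scale0r add0r (plift_gen op_bilin rel_ok). Qed.

Lemma UCTD_lift_morphism : uctd_morphism UCTD_lift.
Proof.
have lp := plift_linear op_bilin rel_ok.
split.
- apply: mk_linear => [x y|a x]; rewrite /UCTD_lift /=.
    by rewrite (linhD lp) scalerDl addrACA.
  by rewrite (linhZ lp) scalerDr scalerA.
- by rewrite /UCTD_lift /= scale1r (linh0 lp) addr0.
- move=> [a x] ax; have {ax a}-> : a = 0 := ax; rewrite /UCTD_lift /= scale0r add0r.
  by rewrite /plift aug_eval.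
- move=> [a x] [b y] ax ay; have {ax a}-> : a = 0 := ax; have {ay b}-> : b = 0 := ay.
  by rewrite /UCTD_lift /= !scale0r !add0r (plift_op op_bilin rel_ok).
- move=> [a x] [b y] ax ay; have {ax a}-> : a = 0 := ax; have {ay b}-> : b = 0 := ay.
  by rewrite /UCTD_lift /= !scale0r !add0r (plift_op op_bilin rel_ok).
Qed.

End UCTDLift.
End UCTDTheory.

Section UCTDBialgebra.
Variables (K : fieldType) (R : nuComAlgType K).
Notation U := (UCTD R).
Notation gen := (@UCTD_gen K R).

Definition UCTD_comul : U -> tensor U U :=
  UCTD_lift (fun r : R => gen r ⊗ uone + uone ⊗ gen r).

Let copr_linear : linear (fun r : R => gen r ⊗ uone + uone ⊗ gen r : tensor U U).
Proof.
by apply: linear_add => a r s; rewrite UCTD_gen_linear;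
  [apply: (tens_bilin _ _).1 | apply: (tens_bilin _ _).2].
Qed.

Let copr_aug r : aug (gen r ⊗ uone + uone ⊗ gen r : tensor U U) = 0.
Proof.
by rewrite augD ![aug (_ ⊗ _)]tens_augE aug_UCTD_gen mul0r mulr0 addr0.
Qed.

Let copr_mul (r s : R) : gen (nmul r s) ⊗ uone + uone ⊗ gen (nmul r s) =
  dot (gen r ⊗ uone + uone ⊗ gen r : tensor U U) (gen s ⊗ uone + uone ⊗ gen s).
Proof.
by rewrite UCTD_gen_mul tens_prim_dot // aug_UCTD_gen.
Qed.

Lemma UCTD_comul_gen r : UCTD_comul (gen r) = gen r ⊗ uone + uone ⊗ gen r.
Proof. exact: UCTD_lift_gen. Qed.

Lemma UCTD_comul_morphism : uctd_morphism UCTD_comul.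
Proof. exact: UCTD_lift_morphism. Qed.

Let lc := uctdm_linear UCTD_comul_morphism.

Lemma UCTD_comulA x :
  tassoc (tmap UCTD_comul id (UCTD_comul x)) = tmap id UCTD_comul (UCTD_comul x).
Proof.
have cm := UCTD_comul_morphism; have im := @id_uctd_morphism K U.
have m1 := uctd_morphism_comp (uctd_morphism_comp cm (tmap_uctd_morphism cm im))
  (@tassoc_uctd_morphism K U U U).
have m2 := uctd_morphism_comp cm (tmap_uctd_morphism im cm).
apply: (UCTD_morphism_ext m1 m2) => {x} r.
exact: (prim_coassoc cm (UCTD_comul_gen r)).
Qed.

Lemma UCTD_counitl x : tlift (fun a b : U => aug a *: b) (UCTD_comul x) = x.
Proof.
have m1 := uctd_morphism_comp UCTD_comul_morphism (@epsl_morphism K U).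
apply: (UCTD_morphism_ext m1 (@id_uctd_morphism K U)) => r.
exact: (prim_counitl (aug_UCTD_gen r) (UCTD_comul_gen r)).
Qed.

Lemma UCTD_counitr x : tlift (fun a b : U => aug b *: a) (UCTD_comul x) = x.
Proof.
have m1 := uctd_morphism_comp UCTD_comul_morphism (@epsr_morphism K U).
apply: (UCTD_morphism_ext m1 (@id_uctd_morphism K U)) => r.
exact: (prim_counitr (aug_UCTD_gen r) (UCTD_comul_gen r)).
Qed.

HB.instance Definition _ := isCoalgebra.Build K (UCTD R)
  lc (@aug_linear K U) UCTD_comulA UCTD_counitl UCTD_counitr.
HB.instance Definition _ := isCTDBialgebra.Build K (UCTD R)
  (fun=> erefl) UCTD_comul_morphism.

End UCTDBialgebra.

(* The tensor module [T(V)] is the space of linear combinations of words in [V],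
   modulo multilinearity in each letter. *)

Inductive word_rel (K : fieldType) (V : lmodType K) :
    expr K (seq V) void -> expr K (seq V) void -> Prop :=
  | WR_lin s t a (u v : V) : word_rel (EGen (s ++ (a *: u + v) :: t))
      (EAdd (EScale a (EGen (s ++ u :: t))) (EGen (s ++ v :: t))).

Definition tensor_coalg (K : fieldType) (V : lmodType K) : Type :=
  presented (@word_rel K V).

HB.instance Definition _ (K : fieldType) (V : lmodType K) :=
  GRing.Lmodule.on (tensor_coalg V).

Definition word (K : fieldType) (V : lmodType K) (w : seq V) : tensor_coalg V :=
  pgen (@word_rel K V) w.

Section TensorCoalgebra.
Variables (K : fieldType) (V : lmodType K).
Notation T := (tensor_coalg V).

Definition word_linear (W : lmodType K) (f : seq V -> W) : Prop :=
  forall s t, linear (fun v => f (s ++ v :: t)).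

Lemma word_word_linear : word_linear (@word K V).
Proof.
move=> s t a u v /=.
have /(EC_rel (rels := @word_rel K V))/pclassP := WR_lin s t a u v.
by rewrite pclassD pclassZ.
Qed.

Definition wlift (W : lmodType K) (f : seq V -> W) : T -> W :=
  plift f (@no_op W).

Section WLift.
Variables (W : lmodType K) (f : seq V -> W).
Hypothesis lf : word_linear f.

Let no_op_bilin (o : void) : bilin (@no_op W o). Proof. by case: o. Qed.
Let f_rel s t : word_rel s t -> evalE f (@no_op W) s = evalE f (@no_op W) t.
Proof. by case=> p q a u v /=; rewrite (lf p q). Qed.

Lemma wlift_word w : wlift f (word w) = f w.
Proof. exact: (plift_gen no_op_bilin f_rel). Qed.

Lemma wlift_linear : linear (wlift f).
Proof. exact: (plift_linear no_op_bilin f_rel). Qed.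

End WLift.

Lemma word_ind (P : T -> Prop) : (forall w, P (word w)) -> P 0 ->
  (forall x y, P x -> P y -> P (x + y)) -> (forall a x, P x -> P (a *: x)) ->
  forall x, P x.
Proof. by move=> Pw P0 PD PZ; elim/presented_ind => // -[]. Qed.

Lemma word_ext (W : lmodType K) (f g : T -> W) : linear f -> linear g ->
  (forall w, f (word w) = g (word w)) -> f =1 g.
Proof.
move=> lf lg fg; elim/word_ind => // [|x y hx hy|a x hx].
- by rewrite (linh0 lf) (linh0 lg).
- by rewrite (linhD lf) (linhD lg) hx hy.
- by rewrite (linhZ lf) (linhZ lg) hx.
Qed.

Definition deconc_word (w : seq V) : tensor T T :=
  \sum_(i < (size w).+1) word (take i w) ⊗ word (drop i w).
Definition deconc : T -> tensor T T := wlift deconc_word.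

Definition empty_word (w : seq V) : K := (nilp w)%:R.
Definition tc_counit : T -> K := @wlift K^o empty_word.

Lemma empty_word_linear : @word_linear K^o empty_word.
Proof.
have E s (v : V) t : empty_word (s ++ v :: t) = 0 by case: s.
by move=> s t a u v; rewrite !E scaler0 addr0.
Qed.

Let wlinD s t (u v : V) :
  word (s ++ (u + v) :: t) = word (s ++ u :: t) + word (s ++ v :: t).
Proof. exact: (linhD (word_word_linear s t)). Qed.
Let wlinZ s t a (u : V) : word (s ++ (a *: u) :: t) = a *: word (s ++ u :: t).
Proof. exact: (linhZ (word_word_linear s t)). Qed.

Lemma deconc_word_linear : word_linear deconc_word.
Proof.
have sz s t (u v : V) : size (s ++ u :: t) = size (s ++ v :: t).
  by rewrite !size_cat.
move=> s t; apply: mk_linear => [u v|a u]; rewrite /deconc_word.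
  rewrite (sz s t _ 0) (sz s t u 0) (sz s t v 0) -big_split /=.
  apply: eq_bigr => i _; rewrite !take_cat !drop_cat; case: ltnP => h.
    by rewrite wlinD tensDr.
  case: (i - size s)%N => [|j] /=; last by rewrite wlinD tensDl.
  by rewrite (wlinD [::]) tensDr.
rewrite (sz s t _ 0) (sz s t u 0) scaler_sumr.
apply: eq_bigr => i _; rewrite !take_cat !drop_cat; case: ltnP => h.
  by rewrite wlinZ tensZr.
case: (i - size s)%N => [|j] /=; last by rewrite wlinZ tensZl.
by rewrite (wlinZ [::]) tensZr.
Qed.

Lemma deconcE w : deconc (word w) =
  \sum_(i < (size w).+1) word (take i w) ⊗ word (drop i w).
Proof. exact: (wlift_word deconc_word_linear). Qed.

Lemma deconc_linear : linear deconc.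
Proof. exact: (wlift_linear deconc_word_linear). Qed.

Lemma tc_counitE w : tc_counit (word w) = (nilp w)%:R.
Proof. exact: (wlift_word empty_word_linear). Qed.

Lemma tc_counit_scalar : scalar tc_counit.
Proof. exact: (wlift_linear empty_word_linear). Qed.

Let tc_counitD x y : tc_counit (x + y) = tc_counit x + tc_counit y.
Proof. exact: (linhD (wlift_linear empty_word_linear)). Qed.
Let tc_counitZ a x : tc_counit (a *: x) = a * tc_counit x.
Proof. exact: (linhZ (wlift_linear empty_word_linear)). Qed.

Let cons_word_linear (v : V) : word_linear (fun w => word (v :: w)).
Proof. by move=> s t; apply: (word_word_linear (v :: s)). Qed.
Let consT (v : V) : T -> T := wlift (fun w => word (v :: w)).
Let consT_linear v : linear (consT v).
Proof. exact: (wlift_linear (cons_word_linear v)). Qed.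
Let consTE v w : consT v (word w) = word (v :: w).
Proof. exact: (wlift_word (cons_word_linear v)). Qed.

Let id_linear (W : lmodType K) : linear (@id W). Proof. by []. Qed.

Let deconc_cons v w : deconc (word (v :: w)) =
  word [::] ⊗ word (v :: w) + tmap (consT v) id (deconc (word w)).
Proof.
rewrite !deconcE big_ord_recl take0 drop0; congr (_ + _).
rewrite (linh_sum (tmap_linear (consT_linear v) (@id_linear T))).
apply: eq_bigr => i _.
by rewrite (tmap_tens _ _ (consT_linear v) (@id_linear T)) consTE.
Qed.

Lemma deconcA x : tassoc (tmap deconc id (deconc x)) = tmap id deconc (deconc x).
Proof.
have ld := deconc_linear; have li := @id_linear T.
have lt := @tassoc_linear K T T T.
have l1 := tmap_linear ld li; have l2 := tmap_linear li ld.
move: x; apply: word_ext => [||w].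
- exact: linh_comp lt (linh_comp l1 ld).
- exact: linh_comp l2 ld.
have d0 : deconc (word [::]) = word [::] ⊗ word [::].
  by rewrite deconcE big_ord_recl big_ord0 addr0.
elim: w => [|v w IH]; first by rewrite d0 !tmap_tens // d0 tassoc_tens.
have lv := consT_linear v.
rewrite deconc_cons (linhD l1) (linhD l2) (linhD lt) !tmap_tens // d0 tassoc_tens.
rewrite deconc_cons tensDr -addrA; congr (_ + _).
have -> : tmap id deconc (tmap (consT v) id (deconc (word w))) =
    tmap (consT v) id (tmap id deconc (deconc (word w))).
  elim/tens_ind: (deconc _) => [a b|y z hy hz].
    by rewrite !tmap_tens.
  by rewrite !(linhD l2, linhD (tmap_linear lv li), linhD (tmap_linear lv (@id_linear _)))
    hy hz.
rewrite -IH.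
have dc a : deconc (consT v a) =
    word [::] ⊗ consT v a + tmap (consT v) id (deconc a).
  move: a; apply: word_ext => [||a]; last by rewrite consTE deconc_cons.
    exact: linh_comp ld lv.
  apply: linear_add; last exact: linh_comp (tmap_linear lv li) ld.
  exact: linh_comp ((@tens_bilin K T T).2 _) lv.
have li2 := @id_linear (tensor T T).
have Eb (y : tensor T T) (b : T) : tassoc (tmap (consT v) id y ⊗ b) =
    tmap (consT v) id (tassoc (y ⊗ b)).
  elim/tens_ind: y => [a1 a2|y z hy hz].
    by rewrite tmap_tens // !tassoc_tens tmap_tens.
  rewrite (linhD (tmap_linear lv li)) !tensDl !(linhD lt).
  by rewrite (linhD (tmap_linear lv li2)) hy hz.
elim/tens_ind: (deconc _) => [a b|y z hy hz].
  by rewrite !tmap_tens // dc tensDl (linhD lt) tassoc_tens Eb.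
rewrite !(linhD (tmap_linear lv li)) (linhD l1) (linhD lt) hy hz tensDr.
by rewrite (linhD l1) (linhD lt) (linhD (tmap_linear lv li2)) addrACA.
Qed.

Lemma tc_counitl x : tlift (fun a b => tc_counit a *: b) (deconc x) = x.
Proof.
have bf : bilin (fun a b : T => tc_counit a *: b).
  split=> u; apply: mk_linear => [y z|k y]; rewrite ?scalerDr //.
  - by rewrite tc_counitD scalerDl.
  - by rewrite tc_counitZ scalerA.
  - by rewrite !scalerA mulrC.
have lb := tlift_linear bf.
move: x; apply: word_ext => [||w] //; first exact: linh_comp lb deconc_linear.
rewrite deconcE (linh_sum lb) big_ord_recl (tlift_tens bf) tc_counitE take0 drop0.
rewrite scale1r big1 ?addr0 // => i _; rewrite (tlift_tens bf) tc_counitE.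
by case: w i => [[]//|v w] i; rewrite scale0r.
Qed.

Lemma tc_counitr x : tlift (fun a b => tc_counit b *: a) (deconc x) = x.
Proof.
have bf : bilin (fun a b : T => tc_counit b *: a).
  split=> u; apply: mk_linear => [y z|k y]; rewrite ?scalerDr //.
  - by rewrite !scalerA mulrC.
  - by rewrite tc_counitD scalerDl.
  - by rewrite tc_counitZ scalerA.
have lb := tlift_linear bf.
move: x; apply: word_ext => [||w] //; first exact: linh_comp lb deconc_linear.
rewrite deconcE (linh_sum lb) big_ord_recr (tlift_tens bf) tc_counitE /=.
rewrite take_size drop_size scale1r big1 ?add0r // => i _.
rewrite (tlift_tens bf) tc_counitE /nilp size_drop subn_eq0 leqNgt ltn_ord.
by rewrite scale0r.
Qed.

HB.instance Definition _ := isCoalgebra.Build K (tensor_coalg V)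
  deconc_linear tc_counit_scalar deconcA tc_counitl tc_counitr.

End TensorCoalgebra.

(* Main.v *)
Require Import Defs.
From mathcomp Require Import all_boot all_order all_algebra.
From mathcomp Require Import boolp classical_sets.

(** Let [a] be primitive. Because the coproduct is a morphism for [≺],
    [Δ (a ≺ y) = (a ≺ -) ⊗ id (Δ y) + 1 ⊗ (a ≺ y)] ([comul_prec_primitive]), and
    deconcatenation satisfies the same rule with [a ≺ -] replaced by the prefixing
    of the letter [a]. Hence [a1 a2 ... an |-> a1 ≺ (a2 ≺ (... ≺ an))] is a coalgebra
    morphism [psi] from the tensor coalgebra on the primitive elements to [H].

    If [H] is connected, [psi] is bijective. Its inverse is built from a projection
    [q] of [H] onto its primitive part that is characterised by
    [x = counit x + q x1 ≺ x2], where [x1 ⊗ x2] stands for [Δ x]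
    ([primitive_projection]). Such a [q] exists since the equation can be solved
    along the filtration. Convolutions with a map preserving the unit can be
    cancelled ([conv_prec_cancel]), and this implies that [q] takes primitive
    values and that [q (a ≺ y) = counit y *: a] for primitive [a]. Iterating the
    equation expands every [x] in nested products of primitive elements, in a
    unique way ([nested_prec_Prim_bijective]).

    For a commutative algebra [R] the same formula for nested products defines a
    coalgebra morphism [rho] from the tensor coalgebra on [R] to the enveloping
    algebra. It is surjective, since the quasi-shuffle recursion shows that its
    image is closed under both operations ([nested_prec_UCTD_surjective]). When [R]
    is the primitive part of a connected [H], the composite of [rho] with the
    canonical morphism from the enveloping algebra to [H] is the bijection [psi],
    so that this morphism is an isomorphism of bialgebras.

    Conversely, a bialgebra is connected if it is the image of a coalgebra morphism
    from a tensor coalgebra that sends the empty word to the unit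
    ([connected_of_coalg_surjection]). This applies to the enveloping algebra by
    means of [rho], and to a bialgebra that is isomorphic to a tensor coalgebra
    because the empty word is the only group-like element of the latter
    ([grouplike_nil]). *)

Set Implicit Arguments.
Unset Strict Implicit.
Unset Printing Implicit Defensive.

Import GRing.Theory.
Local Open Scope ring_scope.

(** * Linear algebra *)

Section Linear.
Variable K : fieldType.
Implicit Types U V W : lmodType K.

Lemma linear_id V : linear (fun x : V => x).
Proof. by []. Qed.

Lemma linear_zero U V : linear (fun _ : U => 0 : V).
Proof. by move=> a x y; rewrite scaler0 addr0. Qed.

Lemma linear_sub U V (f g : U -> V) :
  linear f -> linear g -> linear (fun x => f x - g x).
Proof.
move=> lf lg; apply: linear_add lf _ => a x y.
by rewrite lg opprD scalerN.
Qed.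

Lemma bilin_linear U U' V V' W (o : U' -> V' -> W) (f : U -> U') (g : V -> V') :
  bilin o -> linear f -> linear g -> bilin (fun a b => o (f a) (g b)).
Proof.
move=> bo lf lg; split=> [b|a] k x y /=.
  by rewrite lf (bo.1 _).
by rewrite lg (bo.2 _).
Qed.

Lemma tlift_tmap (U U' V V' W : lmodType K) (o : U' -> V' -> W) (f : U -> U')
    (g : V -> V') t : bilin o -> linear f -> linear g ->
  tlift o (tmap f g t) = tlift (fun u v => o (f u) (g v)) t.
Proof.
move=> bo lf lg; have bt := bilin_linear bo lf lg.
move: t; apply: tens_ext => [||u v].
- exact: linh_comp (tlift_linear bo) (tmap_linear lf lg).
- exact: tlift_linear bt.
- by rewrite tmap_tens // !tlift_tens.
Qed.

Lemma injective_surjective_bijective (S T : Type) (f : S -> T) :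
  injective f -> (forall y, exists x, f x = y) -> bijective f.
Proof.
move=> fI /choice[g fg]; exists g => // x.
by apply: fI; rewrite fg.
Qed.

(** By Zorn's lemma some subspace is maximal among those that avoid [v]. It is a
    complement of the line spanned by [v], and [l] reads the coordinate along
    this line. *)
Lemma separating_functional V (v : V) : v != 0 ->
  exists2 l : V -> K, scalar l & l v = 1.
Proof.
move=> v0.
(* The empty set satisfies [P], as the union of the empty chain has to. *)
pose P (M : set V) := ~ M v /\ forall a x y, M x -> M y -> M (a *: x + y).
have [F FP Ftot|M [[Mv Mlin] Mmax]] := @Zorn_bigcup _ P.
  split=> [[X FX Xv]|a x y [X FX Xx] [Y FY Yy]]; first exact: (FP X FX).1.
  have [XY|YX] := Ftot _ _ FX FY.
    by exists Y => //; apply: (FP Y FY).2 => //; apply: XY.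
  by exists X => //; apply: (FP X FX).2 => //; apply: YX.
have M0 : M 0.
  have [[x Mx]|Mempty] := pselect (exists x, M x).
    by have := Mlin (-1) x x Mx Mx; rewrite scaleN1r addNr.
  case: (Mmax [set 0]%classic).
    by split=> [x Mx|/(_ 0 erefl) M0]; case: Mempty; [exists x|exists 0].
  by split=> [/= v0'|a x y /= -> ->]; [rewrite v0' eqxx in v0|rewrite scaler0 addr0].
have MZ a x : M x -> M (a *: x) by move=> Mx; rewrite -[_ *: _]addr0; apply: Mlin.
have MD x y : M x -> M y -> M (x + y) by rewrite -{2}[x]scale1r; apply: Mlin.
have coord x : exists c, M (x - c *: v).
  have [Mx|nMx] := pselect (M x); first by exists 0; rewrite scale0r subr0.
  (* The span of [M] and [x], which contains [v] because [M] is maximal. *)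
  pose M' : set V := fun y => exists2 c, True & M (y - c *: x).
  have [[c _ Mc]|nM'v] := pselect (M' v).
    exists c^-1; have c0 : c != 0.
      by apply: contra_notN Mv => /eqP c0; rewrite c0 scale0r subr0 in Mc.
    have -> : x - c^-1 *: v = (- c^-1) *: (v - c *: x).
      by rewrite scalerBr !scaleNr scalerA mulVf // scale1r opprK addrC.
    exact: MZ.
  case: (Mmax M').
    split=> [y My|M'M]; first by exists 0; rewrite // scale0r subr0.
    by apply/nMx/M'M; exists 1; rewrite // scale1r subrr.
  split=> // a y z [c _ My] [d _ Mz]; exists (a * c + d) => //.
  have -> : a *: y + z - (a * c + d) *: x = a *: (y - c *: x) + (z - d *: x).
    by rewrite scalerBr scalerA scalerDl opprD addrACA.
  exact: Mlin.
(* The coordinate is unique, hence linear, because [M] avoids [v]. *)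
have uniq x c d : M (x - c *: v) -> M (x - d *: v) -> c = d.
  move=> Mc /(MZ (-1)) /(MD _ _ Mc).
  rewrite scaleN1r opprB addrC addrA subrK -scalerBl => Mdc.
  apply/eqP; rewrite eq_sym -subr_eq0; apply: contra_notT Mv => dc0.
  by have := MZ (d - c)^-1 _ Mdc; rewrite scalerA mulVf // scale1r.
have [l lP] := choice coord; exists l.
  move=> a x y; apply: (uniq (a *: x + y)) => //.
  rewrite scalerDl -scalerA opprD addrACA -scalerBr; exact: Mlin.
by apply: (uniq v); rewrite // scale1r subrr.
Qed.
End Linear.

(** * Convolution *)

Section Convolution.
Variables (K : fieldType) (C : coalgType K).
Implicit Types A B D E F G : lmodType K.

(** Convolution along an arbitrary bilinear map: the same calculus is applied to
    the half-product, to the tensor product, and to the prefixing of a letter to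
    a word. *)
Definition conv A B D (o : A -> B -> D) (f : C -> A) (g : C -> B) (x : C) : D :=
  tlift (fun a b => o (f a) (g b)) (comul x).

Lemma conv_linear A B D (o : A -> B -> D) f g :
  bilin o -> linear f -> linear g -> linear (conv o f g).
Proof.
by move=> bo lf lg; apply: linh_comp (tlift_linear _) comul_linear; apply: bilin_linear.
Qed.

Lemma eq_conv A A' B B' D (o : A -> B -> D) (o' : A' -> B' -> D) f f' g g' :
  (forall a b, o (f a) (g b) = o' (f' a) (g' b)) -> conv o f g =1 conv o' f' g'.
Proof.
by move=> E x; congr (tlift _ _); apply/funext => a; apply/funext.
Qed.

Lemma linear_conv A B D E (o : A -> B -> D) f g (h : D -> E) x :
  bilin o -> linear f -> linear g -> linear h ->
  h (conv o f g x) = conv (fun a b => h (o a b)) f g x.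
Proof.
move=> bo lf lg lh; have bfg := bilin_linear bo lf lg.
have bh : bilin (fun a b => h (o (f a) (g b))).
  by split=> [b|a]; apply: linh_comp lh _; [apply: bfg.1|apply: bfg.2].
rewrite /conv; move: (comul x); apply: tens_ext => [||a b].
- exact: linh_comp lh (tlift_linear bfg).
- exact: tlift_linear bh.
- by rewrite !tlift_tens.
Qed.

Lemma convDl A B D (o : A -> B -> D) f f' g x :
  bilin o -> linear f -> linear f' -> linear g ->
  conv o (fun a => f a + f' a) g x = conv o f g x + conv o f' g x.
Proof.
move=> bo lf lf' lg; have b1 := bilin_linear bo lf lg.
have b2 := bilin_linear bo lf' lg.
have b3 := bilin_linear bo (linear_add lf lf') lg.
rewrite /conv; move: (comul x); apply: (tens_ext (tlift_linear b3)) => [|a b].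
  exact: linear_add (tlift_linear b1) (tlift_linear b2).
by rewrite !tlift_tens // (bilinDl bo).
Qed.

Lemma convBl A B D (o : A -> B -> D) f f' g x :
  bilin o -> linear f -> linear f' -> linear g ->
  conv o (fun a => f a - f' a) g x = conv o f g x - conv o f' g x.
Proof.
move=> bo lf lf' lg; apply/esym/eqP; rewrite subr_eq -convDl //; last exact: linear_sub.
by apply/eqP/eq_conv => a b; rewrite subrK.
Qed.

Lemma convDr A B D (o : A -> B -> D) f g g' x :
  bilin o -> linear f -> linear g -> linear g' ->
  conv o f (fun a => g a + g' a) x = conv o f g x + conv o f g' x.
Proof.
move=> bo lf lg lg'; have b1 := bilin_linear bo lf lg.
have b2 := bilin_linear bo lf lg'.
have b3 := bilin_linear bo lf (linear_add lg lg').
rewrite /conv; move: (comul x); apply: (tens_ext (tlift_linear b3)) => [|a b].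
  exact: linear_add (tlift_linear b1) (tlift_linear b2).
by rewrite !tlift_tens // (bilinDr bo).
Qed.

Lemma comul_conv x : comul x = conv (@tens K C C) id id x.
Proof.
have bt := @tens_bilin K C C; rewrite /conv.
by move: (comul x); apply: (tens_ext _ (tlift_linear bt)) => // a b; rewrite tlift_tens.
Qed.

Lemma counitD (x y : C) : counit (x + y) = counit x + counit y.
Proof. by have := @counit_linear K C 1 x y; rewrite /= scale1r mul1r. Qed.
Lemma counitZ a (x : C) : counit (a *: x) = a * counit x.
Proof.
have c0 : counit (0 : C) = 0 by apply: (addIr (counit (0 : C))); rewrite -counitD !add0r.
by have := @counit_linear K C a x 0; rewrite /= addr0 c0 addr0.
Qed.

Lemma counit_scale_linear A (e : A) : linear (fun x : C => counit x *: e).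
Proof.
by apply: mk_linear => [x y|a x]; rewrite ?counitD ?scalerDl // counitZ scalerA.
Qed.

Lemma counitl_bilin A (f : C -> A) : linear f -> bilin (fun a b : C => counit a *: f b).
Proof.
move=> lf; split=> u; apply: mk_linear => [x y|k x].
- by rewrite counitD scalerDl.
- by rewrite counitZ scalerA.
- by rewrite (linhD lf) scalerDr.
- by rewrite (linhZ lf) !scalerA mulrC.
Qed.

Lemma conv_counitl A B D (o : A -> B -> D) (e : A) g x :
  bilin o -> linear g -> conv o (fun y => counit y *: e) g x = o e (g x).
Proof.
move=> bo lg; rewrite -[x in RHS]counitl.
have lc := linh_comp (bo.2 e) lg.
have b0 := counitl_bilin (@linear_id K C); have b1 := counitl_bilin lc.
rewrite /conv; move: (comul x); apply: tens_ext => [||a b].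
- exact/tlift_linear/(bilin_linear bo (counit_scale_linear e) lg).
- exact: (linh_comp lc (tlift_linear b0)).
- rewrite !tlift_tens //; last exact: (bilin_linear bo (counit_scale_linear e) lg).
  by rewrite (bilinZl bo) (linhZ lg) (bilinZr bo).
Qed.

Lemma conv_counitr A B D (o : A -> B -> D) (e : B) f x :
  bilin o -> linear f -> conv o f (fun y => counit y *: e) x = o (f x) e.
Proof.
move=> bo lf; rewrite -[x in RHS]counitr.
have lc := linh_comp (bo.1 e) lf.
have b0 := bilin_flip (counitl_bilin (@linear_id K C)).
have be := bilin_linear bo lf (counit_scale_linear e).
rewrite /conv; move: (comul x); apply: tens_ext => [||a b].
- exact: tlift_linear be.
- exact: (linh_comp lc (tlift_linear b0)).
- by rewrite !tlift_tens // (bilinZr bo) (linhZ lf) (bilinZl bo).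
Qed.

(** Coassociativity turns a pointwise associativity law into one for convolutions.
    Four operations are allowed because the laws in play mix several of them, as
    in [(a ≺ b) ⊗ c = (a ≺ -) (b ⊗ c)]. *)
Lemma conv_assoc A B D E F G (o1 : E -> D -> G) (o2 : A -> B -> E)
    (o3 : A -> F -> G) (o4 : B -> D -> F) f g h x :
  bilin o1 -> bilin o2 -> bilin o3 -> bilin o4 ->
  linear f -> linear g -> linear h ->
  (forall a b c, o1 (o2 a b) c = o3 a (o4 b c)) ->
  conv o1 (conv o2 f g) h x = conv o3 f (conv o4 g h) x.
Proof.
move=> b1 b2 b3 b4 lf lg lh E12.
have b2' := bilin_linear b2 lf lg; have b4' := bilin_linear b4 lg lh.
have lR := tlift_linear b4'; have lL := tlift_linear b2'.
have bM := bilin_linear b3 lf lR; have lM := tlift_linear bM.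
pose M := tlift (fun a t => o3 (f a) (tlift (fun b c => o4 (g b) (h c)) t)).
have li := @linear_id K C; have lc := @comul_linear K C.
have bL := bilin_linear b1 (conv_linear b2 lf lg) lh.
have bR := bilin_linear b3 lf (conv_linear b4 lg lh).
transitivity (M (tassoc (tmap comul id (comul x)))).
  rewrite /conv; move: (comul x); apply: tens_ext => [||a b].
  - exact: tlift_linear bL.
  - exact: linh_comp lM (linh_comp (@tassoc_linear K C C C) (tmap_linear lc li)).
  rewrite tlift_tens // tmap_tens //; move: (comul a); apply: tens_ext => [||u v].
  - exact: (linh_comp (b1.1 _) lL).
  - exact: (linh_comp lM (linh_comp (@tassoc_linear K C C C) ((@tens_bilin _ _ _).1 b))).
  by rewrite tlift_tens // tassoc_tens /M !tlift_tens.
rewrite comulA /conv; move: (comul x); apply: tens_ext => [||a b].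
- exact: linh_comp lM (tmap_linear li lc).
- exact: tlift_linear bR.
by rewrite tmap_tens // /M !tlift_tens.
Qed.

End Convolution.

(** * The filtration by the reduced coproduct *)

Section TensorSubspace.
Variables (K : fieldType) (U V : lmodType K) (P : U -> Prop) (Q : V -> Prop).

Lemma tens_subspaceD s t :
  tens_subspace P Q s -> tens_subspace P Q t -> tens_subspace P Q (s + t).
Proof.
case=> m [u [v [Pu Qv ->]]] [n [u' [v' [Pu' Qv' ->]]]].
exists (m + n)%N, (fun i => match split i with inl j => u j | inr j => u' j end),
  (fun i => match split i with inl j => v j | inr j => v' j end).
split=> [i|i|]; [by case: split|by case: split|].
rewrite big_split_ord; congr (_ + _); apply: eq_bigr => i _.
  by rewrite (unsplitK (inl _ i)).
by rewrite (unsplitK (inr _ i)).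
Qed.

Lemma tens_subspaceZ a t : (forall b x, P x -> P (b *: x)) ->
  tens_subspace P Q t -> tens_subspace P Q (a *: t).
Proof.
move=> PZ [n [u [v [Pu Qv ->]]]]; exists n, (fun i => a *: u i), v.
split=> // [i|]; first exact: PZ.
by rewrite scaler_sumr; apply: eq_bigr => i _; rewrite tensZl.
Qed.

Lemma tens_subspaceS (P' : U -> Prop) (Q' : V -> Prop) t :
  (forall x, P x -> P' x) -> (forall y, Q y -> Q' y) ->
  tens_subspace P Q t -> tens_subspace P' Q' t.
Proof.
move=> PP' QQ' [n [u [v [Pu Qv ->]]]]; exists n, u, v.
by split=> // i; [apply: PP'|apply: QQ'].
Qed.

Lemma tens_subspace0 : tens_subspace P Q 0.
Proof.
exists 0%N, (fun=> 0), (fun=> 0); split=> [[]//|[]//|].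
by rewrite big_ord0.
Qed.

Lemma tens_subspace_tens u v : P u -> Q v -> tens_subspace P Q (u ⊗ v).
Proof. by exists 1%N, (fun=> u), (fun=> v); rewrite big_ord1. Qed.

Lemma tens_subspace_sum n (F : 'I_n -> tensor U V) :
  (forall i, tens_subspace P Q (F i)) -> tens_subspace P Q (\sum_(i < n) F i).
Proof.
move=> HF; apply: (big_ind (tens_subspace P Q)) => //.
  exact: tens_subspace0.
exact: tens_subspaceD.
Qed.

End TensorSubspace.

Section Filtration.
Variables (K : fieldType) (H : ctdBialgType K).
Implicit Types (x y : H).

Lemma comul_uone : comul (uone : H) = uone ⊗ uone.
Proof. exact: uctdm_one comul_uctd_morphism. Qed.

Lemma aug_comul x : aug (comul x) = aug x.
Proof. exact: (uctdm_aug comul_uctd_morphism). Qed.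

Lemma filtrD_Z r : (forall x y, filtr r x -> filtr r y -> filtr r (x + y)) /\
  (forall a x, filtr r x -> filtr r (a *: x)).
Proof.
elim: r => [|r [FD FZ]].
  split=> [_ _ [a ->] [b ->]|a _ [b ->]].
    by exists (a + b); rewrite scalerDl.
  by exists (a * b); rewrite scalerA.
split=> [x y Fx Fy|a x Fx] /=.
  by rewrite (linhD (@reduced_comul_linear K H)); apply: tens_subspaceD.
by rewrite (linhZ (@reduced_comul_linear K H)); apply: tens_subspaceZ.
Qed.

Lemma filtrD r x y : filtr r x -> filtr r y -> filtr r (x + y).
Proof. exact: (filtrD_Z r).1. Qed.
Lemma filtrZ r a x : filtr r x -> filtr r (a *: x).
Proof. exact: (filtrD_Z r).2. Qed.

Lemma filtr_uone r : filtr r (uone : H).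
Proof.
elim: r => [|r IH] /=; first by exists 1; rewrite scale1r.
rewrite /reduced_comul comul_uone subrr add0r -scaleN1r -tensZl.
by apply: tens_subspace_tens => //; apply: filtrZ.
Qed.

Lemma filtrS r x : filtr r x -> filtr r.+1 x.
Proof.
elim: r x => [|r IH] x; first by case=> a ->; apply/filtrZ/filtr_uone.
by apply: tens_subspaceS.
Qed.

Lemma filtr_leq r s x : (r <= s)%N -> filtr r x -> filtr s x.
Proof.
move=> /subnKC <- Fx; elim: (s - r)%N => [|k IH]; first by rewrite addn0.
by rewrite addnS; apply: filtrS.
Qed.

(** On the next filtration step, a convolution involves the values at [x] and at
    the unit, and otherwise only values on the previous step. All inductions along
    the filtration go through this formula. *)
Lemma conv_filtr r x : filtr r.+1 x -> exists n (u v : 'I_n -> H),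
  [/\ forall i, filtr r (u i), forall i, filtr r (v i) &
   forall (A B D : lmodType K) (o : A -> B -> D) f g,
     bilin o -> linear f -> linear g ->
     conv o f g x = o (f x) (g uone) + o (f uone) (g x)
                    + \sum_(i < n) o (f (u i)) (g (v i))].
Proof.
case=> n [u [v [Fu Fv E]]]; exists n, u, v; split=> // A B D o f g bo lf lg.
have bfg := bilin_linear bo lf lg; have lt := tlift_linear bfg.
have -> : conv o f g x = tlift (fun a b => o (f a) (g b))
    (x ⊗ uone + uone ⊗ x + reduced_comul x).
  by congr (tlift _ _); rewrite /reduced_comul [x ⊗ _ + _]addrC [RHS]addrC addrA !subrK.
rewrite E !(linhD lt) (linh_sum lt) !tlift_tens //; congr (_ + _).
by apply: eq_bigr => i _; rewrite tlift_tens.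
Qed.

Lemma conv_uone (A B D : lmodType K) (o : A -> B -> D) (f : H -> A) g :
  bilin o -> linear f -> linear g -> conv o f g uone = o (f uone) (g uone).
Proof.
move=> bo lf lg; rewrite /conv comul_uone tlift_tens //.
exact: bilin_linear.
Qed.

(** A sequence of linear maps whose restrictions to each filtration step are
    eventually constant has a pointwise limit; the filtration being increasing,
    any two vectors lie in a common step, so the limit is linear. *)
Lemma connected_linear_limit (W : lmodType K) (h : nat -> H -> W) :
  connected H -> (forall n, linear (h n)) ->
  (forall r x n, filtr r x -> (r <= n)%N -> h n x = h r x) ->
  exists2 l : H -> W, linear l & forall r x, filtr r x -> l x = h r x.
Proof.
move=> Hconn lh stab; have [N FN] := choice Hconn.
have hE r x : filtr r x -> h (N x) x = h r x.
  move=> Fx; rewrite -(stab _ _ (maxn (N x) r) Fx (leq_maxr _ _)).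
  by rewrite (stab _ _ (maxn (N x) r) (FN x) (leq_maxl _ _)).
exists (fun x => h (N x) x) => // a x y; set m := maxn (N x) (N y).
have Fx : filtr m x by apply: filtr_leq (FN x); apply: leq_maxl.
have Fy : filtr m y by apply: filtr_leq (FN y); apply: leq_maxr.
by rewrite !(hE m) ?lh //; apply: filtrD => //; apply: filtrZ.
Qed.

End Filtration.

(** * Half-products with a primitive element *)

Section TensorPrec.
Variables (K : fieldType) (A : uctdAlgType K).
Implicit Types (a : A) (t : tensor A A).

Lemma prec_linear a : linear (prec a).
Proof. exact: (@prec_bilin K A).2. Qed.

Lemma prec_tens_uone a t : aug a = 0 -> prec (a ⊗ uone) t = tmap (prec a) id t.
Proof.
move=> ha; have lp := tmap_linear (prec_linear a) (@linear_id K A).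
elim/tens_ind: t => [x y|t u ht hu]; last by rewrite precDr (linhD lp) ht hu.
rewrite [LHS]tens_precE tmap_tens; [|exact: prec_linear|by []].
by rewrite star1x ha mul0r scale0r addr0.
Qed.

Lemma tmap_prec_bilin : bilin (fun a t => tmap (prec a) (fun x : A => x) t).
Proof.
have lp a := tmap_linear (prec_linear a) (@linear_id K A).
split=> [t|a]; last exact: lp.
apply: mk_linear => [a b|k a]; elim/tens_ind: t => [y z|y z hy hz].
- by rewrite !tmap_tens ?precDl ?tensDl //; apply: prec_linear.
- by rewrite !(linhD (lp _)) hy hz addrACA.
- by rewrite !tmap_tens ?precZl ?tensZl //; apply: prec_linear.
- by rewrite !(linhD (lp _)) hy hz scalerDr.
Qed.

(** The case [1 ≺ 1] of the convention for tensor products: the left entries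
    contribute only through their counit. *)
Lemma prec_uone_tens a t :
  prec (uone ⊗ a) t = uone ⊗ prec a (tlift (fun x y => aug x *: y) t).
Proof.
have le := tlift_linear (@epsl_bilin K A).
have l1 : linear (fun x : A => (uone : A) ⊗ prec a x).
  exact: linh_comp ((@tens_bilin _ _ _).2 _) (prec_linear a).
elim/tens_ind: t => [x y|t u ht hu].
  rewrite [LHS]tens_precE (tlift_tens (@epsl_bilin K A)) prec1x tens0l add0r.
  by rewrite aug_one mul1r precZr tensZr.
by rewrite precDr (linhD le) (linhD l1) ht hu.
Qed.

End TensorPrec.

Section BialgebraPrec.
Variables (K : fieldType) (H : ctdBialgType K).
Implicit Types (a x y : H).

Lemma bialg_counitl x : tlift (fun b c => aug b *: c) (comul x) = x.
Proof.
rewrite -[RHS]counitl; congr (tlift _ _); apply/funext => b; apply/funext => c.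
by rewrite counit_aug.
Qed.

Lemma aug_scale_linear (W : lmodType K) (e : W) : linear (fun x : H => aug x *: e).
Proof. by move=> k x y; rewrite augD augZ scalerDl scalerA. Qed.

Lemma conv_augl (A B D : lmodType K) (o : A -> B -> D) (e : A) (g : H -> B) x :
  bilin o -> linear g -> conv o (fun y : H => aug y *: e) g x = o e (g x).
Proof.
move=> bo lg; rewrite -(conv_counitl e x bo lg); apply: eq_conv => a b.
by rewrite counit_aug.
Qed.

Lemma conv_augr (A B D : lmodType K) (o : A -> B -> D) (e : B) (f : H -> A) x :
  bilin o -> linear f -> conv o f (fun y : H => aug y *: e) x = o (f x) e.
Proof.
move=> bo lf; rewrite -(conv_counitr e x bo lf); apply: eq_conv => a b.
by rewrite counit_aug.
Qed.

(** Left multiplication by a primitive element under [≺] obeys the rule of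
    [comul_tcons], which governs the prefixing of a letter to a word under
    deconcatenation. This is the source of the isomorphism with the tensor
    coalgebra. *)
Lemma comul_prec_primitive a y : a \in primitive H ->
  comul (prec a y) = tmap (prec a) id (comul y) + uone ⊗ prec a y.
Proof.
move=> pa; have ha := primitive_aug pa.
rewrite (uctdm_precT comul_uctd_morphism); move/primitiveP: pa => ->.
by rewrite precDl prec_tens_uone // prec_uone_tens bialg_counitl.
Qed.

Lemma conv_prec_primitive (A B D : lmodType K) (o : A -> B -> D) (f : H -> A) g a y :
  bilin o -> linear f -> linear g -> a \in primitive H ->
  conv o f g (prec a y) =
    conv o (fun x => f (prec a x)) g y + o (f uone) (g (prec a y)).
Proof.
move=> bo lf lg pa; have bt := bilin_linear bo lf lg.
rewrite /conv comul_prec_primitive // (linhD (tlift_linear bt)) tlift_tens //.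
by rewrite tlift_tmap //; apply: prec_linear.
Qed.

Lemma aug_conv_prec (A : uctdAlgType K) (f g : H -> A) x :
  linear f -> linear g -> aug (conv prec f g x) = 0.
Proof.
move=> lf lg; have b := bilin_linear (@prec_bilin K A) lf lg.
rewrite /conv; elim/tens_ind: (comul x) => [a y|s t hs ht].
  by rewrite tlift_tens // aug_prec.
by rewrite (linhD (tlift_linear b)) augD hs ht addr0.
Qed.

(** Right cancellation in the convolution algebra for [≺]: on each filtration step
    the leading term of [conv prec E g] at [x] is [E x ≺ 1 = E x]. The two
    properties of the projection onto the primitives are proved by comparing
    convolutions and cancelling. *)
Lemma conv_prec_cancel (A : uctdAlgType K) (E g : H -> A) :
  connected H -> linear E -> linear g -> (forall x, aug (E x) = 0) ->
  g uone = uone -> (forall x, conv prec E g x = 0) -> forall x, E x = 0.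
Proof.
move=> Hconn lE lg augE g1 convE; have bp := @prec_bilin K A.
have E1 : E uone = 0.
  by have := convE uone; rewrite conv_uone // g1 precx1 augE scale0r subr0.
move=> x; have [r] := Hconn x; elim: r x => [_ [a ->]|r IH x].
  by rewrite (linhZ lE) E1 scaler0.
case/conv_filtr=> n [u [v [Fu _ cE]]]; have := convE x.
rewrite cE // g1 precx1 augE scale0r subr0 E1 prec0l addr0 big1 ?addr0 // => i _.
by rewrite IH // prec0l.
Qed.

End BialgebraPrec.

(** * The projection onto the primitive elements *)

Section PrimitiveProjection.
Variables (K : fieldType) (H : ctdBialgType K).
Hypothesis Hconn : connected H.
Implicit Types (a x y : H).

Let J x : H := x - aug x *: uone.

Let J_linear : linear J.
Proof. exact: linear_sub (@linear_id K H) (aug_scale_linear _). Qed.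

Let J_uone : J uone = 0.
Proof. by rewrite /J aug_one scale1r subrr. Qed.

Let aug_J x : aug (J x) = 0.
Proof. by rewrite /J -scaleNr augD augZ aug_one mulr1 subrr. Qed.

Let bprec := @prec_bilin K H.

(** The equation [p ≺ id = J] between convolutions reads [p + p ≺ J = J], because
    [id] is the sum of [J] and the unit of the convolution. Since [J] kills the unit, the iteration
    becomes stationary on each filtration step. *)
Let approx : nat -> H -> H :=
  fix approx n := if n is m.+1 then fun x => J x - conv prec (approx m) J x
                  else fun=> 0.

Let approx_linear n : linear (approx n).
Proof.
elim: n => [|n IH]; first exact: linear_zero.
exact: linear_sub J_linear (conv_linear _ _ _).
Qed.

Let aug_approx n x : aug (approx n x) = 0.
Proof.
case: n => [|n] /=; first exact: aug0.
by rewrite -scaleN1r augD augZ aug_J aug_conv_prec // mulr0 addr0.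
Qed.

Let approx_uone n : approx n uone = 0.
Proof. by case: n => //= n; rewrite conv_uone // J_uone prec0r subr0. Qed.

Let approx_stable r x n : filtr r x -> (r <= n)%N -> approx n x = approx r x.
Proof.
elim: r x n => [|r IH] x n; last case: n => // n.
  by case=> a -> _; rewrite (linhZ (approx_linear n)) approx_uone scaler0.
case/conv_filtr=> m [u [v [Fu _ cE]]] rn /=.
rewrite !cE // J_uone !prec0r !approx_uone !prec0l !add0r.
by congr (_ - _); apply: eq_bigr => i _; rewrite (IH _ n).
Qed.

Let projection_exists : exists p : H -> H,
  [/\ linear p, forall x, aug (p x) = 0 & forall x, conv prec p id x = J x].
Proof.
have [p lp pE] := connected_linear_limit Hconn approx_linear approx_stable.
have augp x : aug (p x) = 0 by have [r /pE->] := Hconn x.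
have p1 : p uone = 0 by rewrite (pE 0%N) //; exists 1; rewrite scale1r.
exists p; split=> // x.
have -> : conv prec p id x = conv prec p (fun y => J y + aug y *: uone) x.
  by apply: eq_conv => a b; rewrite /J subrK.
rewrite convDr //; last exact: aug_scale_linear.
rewrite conv_augr // precx1 augp scale0r subr0.
have [r Fx] := Hconn x; rewrite (pE _ _ (filtrS Fx)) /= addrCA -[RHS]addr0.
congr (_ + _); have [n [u [v [Fu _ cE]]]] := conv_filtr (filtrS Fx).
rewrite !cE // J_uone !prec0r approx_uone p1 !prec0l !add0r.
apply/eqP; rewrite subr_eq0; apply/eqP.
by apply: eq_bigr => i _; rewrite (pE r).
Qed.

Section Properties.
Variable p : H -> H.
Hypotheses (lp : linear p) (augp : forall x, aug (p x) = 0).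
Hypothesis pJ : forall x, conv prec p id x = J x.

Let p_uone : p uone = 0.
Proof.
have := pJ uone.
by rewrite conv_uone // precx1 augp scale0r subr0 J_uone.
Qed.

(** The maps [comul \o p] and [y |-> p y ⊗ 1 + 1 ⊗ p y] have the same convolution
    with [comul], namely [comul \o J]: for the first one because [comul] is
    compatible with [≺], for the second one by coassociativity. *)
Let projection_primitive x : p x \in primitive H.
Proof.
apply/primitiveP/eqP; rewrite -subr_eq0; apply/eqP.
have lc := @comul_linear K H; have bt := @tens_bilin K H H.
have lD : linear (fun y => p y ⊗ (uone : H) + (uone : H) ⊗ p y).
  by apply: linear_add; [apply: (linh_comp (bt.1 _) lp)|apply: (linh_comp (bt.2 _) lp)].
move: x; apply: (conv_prec_cancel Hconn (g := comul)) => //.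
- exact: linear_sub (linh_comp lc lp) lD.
- move=> x; rewrite -scaleN1r !augD augZ aug_comul augp augD.
  by rewrite ![aug (_ ⊗ _)]tens_augE augp mul0r mulr0 addr0 mulr0 addr0.
- exact: (uctdm_one comul_uctd_morphism).
move=> x; rewrite convBl //; [|exact: prec_bilin|exact: linh_comp lc lp].
have -> : conv prec (fun y => comul (p y)) comul x = comul (J x).
  rewrite -pJ (linear_conv _ bprec) //; apply: eq_conv => a b.
  by rewrite -(uctdm_precT comul_uctd_morphism).
rewrite convDl //; first last.
- by apply: (linh_comp (bt.2 _) lp).
- by apply: (linh_comp (bt.1 _) lp).
- exact: prec_bilin.
have -> : conv prec (fun y => p y ⊗ (uone : H)) comul x = comul x - uone ⊗ x.
  transitivity (conv (fun a t => tmap (prec a) id t) p (conv (@tens K H H) id id) x).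
    by apply: eq_conv => a b; rewrite prec_tens_uone -?comul_conv.
  rewrite -(conv_assoc (o1 := @tens K H H) (o2 := prec)) //; first last.
  - by move=> a b c; rewrite tmap_tens //; apply: prec_linear.
  - exact: tmap_prec_bilin.
  transitivity (conv (@tens K H H) J id x).
    by apply: eq_conv => a b; rewrite pJ.
  rewrite convBl //; last exact: aug_scale_linear.
  by rewrite conv_augl // -comul_conv.
have -> : conv prec (fun y => (uone : H) ⊗ p y) comul x = uone ⊗ J x.
  rewrite -pJ (linear_conv _ bprec lp _ (bt.2 uone)) //.
  by apply: eq_conv => a b; rewrite prec_uone_tens bialg_counitl.
have lt := bt.2 (uone : H).
rewrite /J (linhB lc) (linhZ lc) (linhB lt) (linhZ lt) comul_uone.
by rewrite addrA subrK subrr.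
Qed.

(** Both sides, as functions of [y], have convolution [y |-> a ≺ y] with the
    identity. *)
Let projection_prec a y : a \in primitive H -> p (prec a y) = aug y *: a.
Proof.
move=> pa; have lpa := @prec_linear K H a; have lpp := linh_comp lp lpa.
apply/eqP; rewrite -subr_eq0; apply/eqP.
move: y; apply: (conv_prec_cancel Hconn (g := id)) => //.
- exact: linear_sub lpp (aug_scale_linear _).
- by move=> y; rewrite -scaleN1r augD !augZ augp (primitive_aug pa) !mulr0 addr0.
move=> y; rewrite convBl //; last exact: aug_scale_linear.
rewrite conv_augl //; apply/eqP; rewrite subr_eq0 eq_sym; apply/eqP.
have := pJ (prec a y); rewrite conv_prec_primitive // p_uone prec0l addr0 => ->.
by rewrite /J aug_prec scale0r subr0.
Qed.

Let retraction x : Prim H := MkPrim (projection_primitive x).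

Lemma projection_retraction : exists q : H -> Prim H,
  [/\ linear q, q uone = 0,
      forall x, conv (fun (a : Prim H) y => prec (val a) y) q id x = x - aug x *: uone &
      forall (a : Prim H) y, q (prec (val a) y) = aug y *: a].
Proof.
exists retraction; split=> [k x y||x|a y].
- by apply: val_inj; rewrite /= lp.
- exact: val_inj.
- by rewrite -[RHS]/(J x) -pJ; apply: eq_conv.
- by apply: val_inj; rewrite /= projection_prec // (prim_valP a).
Qed.
End Properties.

(** The map [q] plays the part of [letter] on the tensor coalgebra: the third
    property is the analogue of [conv_letter], and expands [x] as a sum of terms
    [a ≺ y] with [a] primitive; the fourth one makes this expansion unique. *)
Lemma primitive_projection : exists q : H -> Prim H,
  [/\ linear q, q uone = 0,
      forall x, conv (fun (a : Prim H) y => prec (val a) y) q id x = x - aug x *: uone &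
      forall (a : Prim H) y, q (prec (val a) y) = aug y *: a].
Proof. by have [p []] := projection_exists; apply: projection_retraction. Qed.

End PrimitiveProjection.

(** * Morphisms and their inverses *)

Section Morphisms.
Variable K : fieldType.

Lemma tmap_comp (U U' U'' V V' V'' : lmodType K) (f : U -> U') (f' : U' -> U'')
    (g : V -> V') (g' : V' -> V'') t :
  linear f -> linear f' -> linear g -> linear g' ->
  tmap f' g' (tmap f g t) = tmap (fun x => f' (f x)) (fun y => g' (g y)) t.
Proof.
move=> lf lf' lg lg'; rewrite /tmap tlift_tmap //.
exact: bilin_linear (@tens_bilin _ _ _) lf' lg'.
Qed.

Lemma inverse_linear (U V : lmodType K) (f : U -> V) g :
  linear f -> cancel f g -> cancel g f -> linear g.
Proof. by move=> lf fK gK a x y; rewrite -{1}[x]gK -{1}[y]gK -lf fK. Qed.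

Lemma coalg_morphism_comp (C D E : coalgType K) (f : C -> D) (g : D -> E) :
  coalg_morphism f -> coalg_morphism g -> coalg_morphism (fun x => g (f x)).
Proof.
move=> [lf df ef] [lg dg eg]; split=> [|x|x]; first exact: linh_comp lg lf.
  by rewrite dg df tmap_comp.
by rewrite eg ef.
Qed.

Lemma coalg_morphism_inverse (C D : coalgType K) (f : C -> D) g :
  coalg_morphism f -> cancel f g -> cancel g f -> coalg_morphism g.
Proof.
move=> [lf df ef] fK gK; have lg := inverse_linear lf fK gK.
split=> // x; last by rewrite -ef gK.
rewrite -[x in RHS]gK df tmap_comp //.
move: (comul _); apply: tens_ext => // [|a b].
  by apply: tmap_linear; apply: linh_comp.
by rewrite tmap_tens ?fK //; apply: linh_comp.
Qed.

Lemma uctd_morphism_inverse (A B : uctdAlgType K) (f : A -> B) g :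
  uctd_morphism f -> cancel f g -> cancel g f -> uctd_morphism g.
Proof.
move=> fm fK gK; have lg := inverse_linear (uctdm_linear fm) fK gK.
apply: mk_uctd_morphism => // [|x|x y|x y]; apply: (can_inj fK) || idtac.
- by rewrite gK (uctdm_one fm).
- by rewrite -(uctdm_aug fm) gK.
- by rewrite (uctdm_precT fm) !gK.
- by rewrite (uctdm_dotT fm) !gK.
Qed.

End Morphisms.

(** * The tensor coalgebra *)

Section TensorModule.
Variables (K : fieldType) (V : lmodType K).
Notation T := (tensor_coalg V).

Lemma foldr_word_linear (A : lmodType K) (o : V -> A -> A) (e : A) :
  bilin o -> word_linear (foldr o e).
Proof.
move=> bo; elim=> [|a s IH] t; first exact: bo.1.
exact: linh_comp (bo.2 a) (IH t).
Qed.

Definition tcons (v : V) : T -> T := wlift (fun w => word (v :: w)).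

Lemma tcons_linear v : linear (tcons v).
Proof. by apply: wlift_linear => s t; apply: (word_word_linear (v :: s)). Qed.

Lemma tcons_word v w : tcons v (word w) = word (v :: w).
Proof. by rewrite /tcons wlift_word // => s t; apply: (word_word_linear (v :: s)). Qed.

Lemma tcons_bilin : bilin tcons.
Proof.
split=> [t|v]; last exact: tcons_linear.
elim/word_ind: t => [w||s t hs ht|a t ht] k u v /=.
- by rewrite !tcons_word (word_word_linear [::]).
- by rewrite !(linh0 (@tcons_linear _)) scaler0 addr0.
- by rewrite !(linhD (@tcons_linear _)) hs ht scalerDr addrACA.
- by rewrite !(linhZ (@tcons_linear _)) ht scalerDr !scalerA mulrC.
Qed.

Lemma comul_nil : comul (word [::] : T) = word [::] ⊗ word [::].
Proof. by rewrite [LHS]deconcE big_ord_recl big_ord0 addr0. Qed.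

Lemma comul_tcons v t :
  comul (tcons v t) = tmap (tcons v) id (comul t) + word [::] ⊗ tcons v t.
Proof.
have lv := @tcons_linear v; have lm := tmap_linear lv (@linear_id K T).
move: t; apply: word_ext => [||w].
- exact: linh_comp comul_linear lv.
- apply: linear_add; first exact: linh_comp lm comul_linear.
  exact: linh_comp ((@tens_bilin _ _ _).2 _) lv.
rewrite tcons_word [LHS]deconcE [comul (word w)]deconcE (linh_sum lm) addrC.
rewrite big_ord_recl take0 drop0; congr (_ + _); apply: eq_bigr => i _.
by rewrite tmap_tens // tcons_word.
Qed.

Lemma counit_nil : counit (word [::] : T) = 1.
Proof. exact: tc_counitE. Qed.

Lemma counit_tcons v t : counit (tcons v t) = 0.
Proof.
move: t; apply: (@word_ext _ _ K^o) => [||w].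
- exact: (@linh_comp K T T K^o) (@counit_linear K T) (@tcons_linear v).
- exact: linear_zero.
- by rewrite tcons_word; rewrite [LHS]tc_counitE.
Qed.

Lemma tens_word_ind (P : T -> Prop) : P (word [::]) ->
  (forall v t, P t -> P (tcons v t)) -> P 0 ->
  (forall x y, P x -> P y -> P (x + y)) -> (forall a x, P x -> P (a *: x)) ->
  forall x, P x.
Proof.
move=> P1 Pc P0 PD PZ; apply: word_ind => //.
by elim=> // v w /(Pc v); rewrite tcons_word.
Qed.

(** The contraction of the first letter with a linear form. It shortens words, and
    it is a left inverse of prefixing a letter at which the form is 1. *)
Definition contraction (l : V -> K) : T -> T :=
  wlift (fun w => if w is v :: w' then l v *: word w' else 0).

Definition letter : T -> V := wlift (fun w => if w is [:: v] then v else 0).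

Lemma letter_word_linear :
  word_linear (fun w : seq V => if w is [:: v] then v else 0).
Proof.
case=> [|a [|b s]] [|c t] //=; exact: linear_zero.
Qed.

Lemma letter_linear : linear letter.
Proof. exact/wlift_linear/letter_word_linear. Qed.

Lemma letter_word w : letter (word w) = if w is [:: v] then v else 0.
Proof. exact/wlift_word/letter_word_linear. Qed.

Lemma letter_tcons v t : letter (tcons v t) = counit t *: v.
Proof.
move: t; apply: word_ext => [||w].
- exact: linh_comp letter_linear (@tcons_linear v).
- exact: counit_scale_linear.
rewrite tcons_word letter_word [counit _]tc_counitE.
by case: w => [|a w]; rewrite ?scale1r ?scale0r.
Qed.

(** In the deconcatenation coproduct of a nonempty word, only the cut after the
    first letter has a left part of length one. *)
Lemma conv_letter t : conv tcons letter id t = t - counit t *: word [::].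
Proof.
have bc := tcons_bilin; have lc := conv_linear bc letter_linear (@linear_id K T).
have lR := linear_sub (@linear_id K T) (@counit_scale_linear K T T (word [::])).
move: t; apply: (word_ext lc lR) => -[|v w].
  rewrite /conv comul_nil tlift_tens; last exact: bilin_linear letter_linear _.
  by rewrite letter_word counit_nil scale1r subrr (bilin0l bc).
rewrite -tcons_word counit_tcons scale0r subr0; set t := word w.
have b1 := bilin_linear bc letter_linear (@linear_id K T).
rewrite /conv comul_tcons (linhD (tlift_linear b1)) tlift_tens //.
rewrite letter_word (bilin0l bc) addr0 tlift_tmap //; last exact: tcons_linear.
transitivity (conv tcons (fun x => counit x *: v) id t).
  apply: (eq_conv (o := tcons) (f := fun x => letter (tcons v x)) (g := id)).
  by move=> a b; rewrite letter_tcons.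
by rewrite conv_counitl.
Qed.

Lemma contraction_word_linear (l : V -> K) : scalar l ->
  word_linear (fun w : seq V => if w is v :: w' then l v *: word w' else 0).
Proof.
move=> ll [|a s] t k u v /=; first by rewrite ll scalerDl scalerA.
by rewrite (word_word_linear s) scalerDr !scalerA mulrC.
Qed.

Lemma contraction_word l w : scalar l ->
  contraction l (word w) = if w is v :: w' then l v *: word w' else 0.
Proof. by move=> ll; apply: (wlift_word (contraction_word_linear ll)). Qed.

Lemma contraction_linear l : scalar l -> linear (contraction l).
Proof. by move=> ll; apply: (wlift_linear (contraction_word_linear ll)). Qed.

Lemma contraction_tcons l v t : scalar l -> contraction l (tcons v t) = l v *: t.
Proof.
move=> ll; move: t; apply: word_ext => [||w].
- exact: linh_comp (contraction_linear ll) (@tcons_linear v).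
- by move=> k x y; rewrite scalerDr !scalerA mulrC.
- by rewrite tcons_word contraction_word.
Qed.

Lemma contraction_nilpotent l t : scalar l ->
  exists N, forall n, (N <= n)%N -> iter n (contraction l) t = 0.
Proof.
move=> ll; have lD := contraction_linear ll.
have lI n : linear (iter n (contraction l)).
  by elim: n => [|n IH] k x y //=; rewrite IH lD.
elim/tens_word_ind: t => [|v t [N IH]||x y [N hx] [M hy]|a x [N hx]].
- exists 1%N => -[|n] // _; rewrite iterSr contraction_word //.
  exact: linh0 (lI n).
- exists N.+1 => -[|n] // Nn.
  by rewrite iterSr contraction_tcons // (linhZ (lI n)) IH // scaler0.
- by exists 0%N => n _; apply: linh0 (lI n).
- exists (maxn N M) => n; rewrite geq_max => /andP[Nn Mn].
  by rewrite (linhD (lI n)) hx // hy // addr0.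
- by exists N => n Nn; rewrite (linhZ (lI n)) hx // scaler0.
Qed.

(** A group-like [t] satisfies [t = 1 + v t] by [conv_letter], with [v] its
    component of length one. If [v] were nonzero, contracting with a form equal to
    1 at [v] would fix [t], although contractions are locally nilpotent. *)
Lemma grouplike_nil (t : T) : comul t = t ⊗ t -> counit t = 1 -> t = word [::].
Proof.
move=> tt t1.
have tE : t = word [::] + tcons (letter t) t.
  have := conv_letter t; rewrite t1 scale1r /conv tt tlift_tens.
    by move=> ->; rewrite addrC subrK.
  exact: bilin_linear tcons_bilin letter_linear _.
have [v0|/separating_functional[l ll lv]] := eqVneq (letter t) 0.
  by rewrite tE v0 (bilin0l tcons_bilin) addr0.
have lt : contraction l t = t.
  rewrite {1}tE (linhD (contraction_linear ll)) contraction_word //.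
  by rewrite contraction_tcons // lv scale1r add0r.
have [N /(_ N (leqnn N)) tN] := contraction_nilpotent t ll.
have t0 : t = 0 by rewrite -tN; elim: (N) => //= n <-.
by have := counitZ 0 t; rewrite scale0r -t0 t1 mul0r => /eqP; rewrite oner_eq0.
Qed.

End TensorModule.

(** * Nested half-products *)

Section NestedPrec.
Variables (K : fieldType) (V : lmodType K) (A : uctdAlgType K).
Variable i : V -> A.
Notation T := (tensor_coalg V).

(** Folding from the unit sends the word [v1 v2 ... vn] to
    [v1 ≺ (v2 ≺ (... ≺ vn))] when [i] takes its values in the augmentation ideal,
    where [x ≺ 1 = x]. *)
Definition nested_prec : T -> A := wlift (foldr (fun v => prec (i v)) uone).

Hypothesis li : linear i.

Let nested_word_linear : word_linear (foldr (fun v => prec (i v)) uone).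
Proof.
apply: foldr_word_linear.
exact: bilin_linear (@prec_bilin K A) li (@linear_id K A).
Qed.

Lemma nested_prec_linear : linear nested_prec.
Proof. exact: wlift_linear nested_word_linear. Qed.

Lemma nested_prec_nil : nested_prec (word [::]) = uone.
Proof. exact: wlift_word nested_word_linear _. Qed.

Lemma nested_prec_tcons v t : nested_prec (tcons v t) = prec (i v) (nested_prec t).
Proof.
have lp := prec_linear (i v).
move: t; apply: word_ext => [||w].
- exact: linh_comp nested_prec_linear (@tcons_linear _ _ v).
- exact: linh_comp lp nested_prec_linear.
- by rewrite tcons_word /nested_prec !(wlift_word nested_word_linear).
Qed.

Section Image.
Hypothesis dot_i : forall u v, exists w, dot (i u) (i v) = i w.

Let im (x : A) := exists t, nested_prec t = x.

Let imD x y : im x -> im y -> im (x + y).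
Proof. by move=> [s <-] [t <-]; exists (s + t); apply: linhD nested_prec_linear _ _. Qed.
Let imZ a x : im x -> im (a *: x).
Proof. by move=> [s <-]; exists (a *: s); apply: linhZ nested_prec_linear _ _. Qed.
Let im0 : im 0.
Proof. by exists 0; apply: linh0 nested_prec_linear. Qed.
Let im1 : im uone.
Proof. by exists (word [::]); apply: nested_prec_nil. Qed.
Let im_prec v x : im x -> im (prec (i v) x).
Proof. by move=> [s <-]; exists (tcons v s); rewrite nested_prec_tcons. Qed.

(** This is the recursion of the quasi-shuffle product for words with first letters
    [u] and [v]; those for [≺] are instances of [prec_prec]. *)
Lemma nested_prec_dot (u v : V) (x y : A) :
  dot (prec (i u) x) (prec (i v) y) = prec (dot (i u) (i v)) (star x y).
Proof. by rewrite -dot_prec dotC -dot_prec prec_prec [dot (i v) _]dotC starC. Qed.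

(** Each product of two nonempty words is a letter [≺] the star product of words of
    smaller total length; the letter is a dot product when both first letters are
    consumed. *)
Let im_words (n : nat) (s t : seq V) : (size s + size t <= n)%N ->
  [/\ im (prec (nested_prec (word s)) (nested_prec (word t))),
      im (prec (nested_prec (word t)) (nested_prec (word s))) &
      im (dot (nested_prec (word s)) (nested_prec (word t)))].
Proof.
elim: n s t => [|n IH] s t.
  rewrite leqn0 addn_eq0 !size_eq0 => /andP[/eqP-> /eqP->].
  by rewrite nested_prec_nil prec11 dot11.
have im_w w : im (nested_prec (word w)) by exists (word w).
have im_star u w : (size u + size w <= n)%N ->
    im (star (nested_prec (word u)) (nested_prec (word w))).
  by move=> /IH[? ? ?]; rewrite starE; do !apply: imD => //; apply: imZ.
case: s t => [|u s] [|v t] stn; rewrite ?nested_prec_nil.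
- by rewrite prec11 dot11.
- by rewrite prec1x dot1x precx1 -scaleNr; split=> //; apply: imD => //; apply: imZ.
- by rewrite prec1x dotx1 precx1 -scaleNr; split=> //; apply: imD => //; apply: imZ.
rewrite -!tcons_word !nested_prec_tcons nested_prec_dot; have [w ->] := dot_i u v.
rewrite !prec_prec -!nested_prec_tcons !tcons_word; split; apply: im_prec;
  apply: im_star; move: stn; rewrite /= !addSn !addnS !ltnS //.
  by rewrite addnC.
exact: ltnW.
Qed.

Lemma nested_prec_image_closed x y : im x -> im y -> im (prec x y) /\ im (dot x y).
Proof.
move=> [s <-] [t <-]; have ln := nested_prec_linear.
elim/word_ind: s => [u||s s' [hp hd] [hp' hd']|a s [hp hd]].
- elim/word_ind: t => [w||t t' [hp hd] [hp' hd']|a t [hp hd]].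
  + by have [] := im_words (leqnn (size u + size w)).
  + by rewrite (linh0 ln) prec0r dot0r.
  + by rewrite (linhD ln) precDr dotDr; split; apply: imD.
  + by rewrite (linhZ ln) precZr dotZr; split; apply: imZ.
- by rewrite (linh0 ln) prec0l dot0l.
- by rewrite (linhD ln) precDl dotDl; split; apply: imD.
- by rewrite (linhZ ln) precZl dotZl; split; apply: imZ.
Qed.

End Image.
End NestedPrec.

Lemma nested_prec_morphism (K : fieldType) (V : lmodType K) (A B : uctdAlgType K)
    (i : V -> A) (f : A -> B) t :
  uctd_morphism f -> linear i ->
  f (nested_prec i t) = nested_prec (fun v => f (i v)) t.
Proof.
move=> fm li; have lf := uctdm_linear fm; have lfi := linh_comp lf li.
have l1 := linh_comp lf (nested_prec_linear li); have l2 := nested_prec_linear lfi.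
elim/tens_word_ind: t => [|v t IH||x y hx hy|a x hx].
- by rewrite !nested_prec_nil // (uctdm_one fm).
- by rewrite !nested_prec_tcons // (uctdm_precT fm) IH.
- by rewrite (linh0 l1) (linh0 l2).
- by rewrite (linhD l1) (linhD l2) hx hy.
- by rewrite (linhZ l1) (linhZ l2) hx.
Qed.

(** The image contains the generators and is closed under the operations. *)
Lemma nested_prec_UCTD_surjective (K : fieldType) (R : nuComAlgType K) (x : UCTD R) :
  exists t, nested_prec (@UCTD_gen K R) t = x.
Proof.
have lg := @UCTD_gen_linear K R; have ln := nested_prec_linear lg.
have dot_gen (r s : R) : exists u, dot (UCTD_gen r) (UCTD_gen s) = UCTD_gen u.
  by exists (nmul r s); rewrite UCTD_gen_mul.
have cl := nested_prec_image_closed lg dot_gen.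
elim/UCTD_ind: x => [|r|x y [s <-] [t <-]|a x [s <-]|x y _ _ hx hy|x y _ _ hx hy].
- by exists (word [::]); apply: nested_prec_nil.
- exists (tcons r (word [::])).
  by rewrite nested_prec_tcons // nested_prec_nil // precx1 aug_UCTD_gen scale0r subr0.
- by exists (s + t); apply: linhD ln _ _.
- by exists (a *: s); apply: linhZ ln _ _.
- exact: (cl _ _ hx hy).1.
- exact: (cl _ _ hx hy).2.
Qed.

Section NestedPrecBialgebra.
Variables (K : fieldType) (V : lmodType K) (H : ctdBialgType K).
Notation T := (tensor_coalg V).

(** By [comul_prec_primitive] and [comul_tcons] both coproducts obey the same
    recursion. *)
Lemma nested_prec_coalg_morphism (i : V -> H) : linear i ->
  (forall v, i v \in primitive H) -> coalg_morphism (nested_prec i).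
Proof.
move=> li pi; have ln := nested_prec_linear li.
have lm := tmap_linear ln ln.
split=> // t; elim/tens_word_ind: t => [|v t IH||x y hx hy|a x hx].
- by rewrite nested_prec_nil // comul_uone comul_nil tmap_tens // nested_prec_nil.
- rewrite nested_prec_tcons // comul_prec_primitive // comul_tcons (linhD lm) IH.
  have lt := @tcons_linear K V v; have lp := prec_linear (i v).
  rewrite tmap_tens // nested_prec_nil // nested_prec_tcons // !tmap_comp //.
  congr (_ + _); congr (tlift _ _); apply/funext => a; apply/funext => b.
  by rewrite nested_prec_tcons.
- by rewrite (linh0 (linh_comp comul_linear ln)) (linh0 (linh_comp lm comul_linear)).
- by rewrite !(linhD ln, linhD comul_linear) (linhD lm) hx hy.
- by rewrite !(linhZ ln, linhZ comul_linear) (linhZ lm) hx.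
- by rewrite nested_prec_nil // counit_aug aug_one counit_nil.
- by rewrite nested_prec_tcons // counit_aug aug_prec counit_tcons.
- rewrite (linh0 ln) -[0 in LHS](scale0r uone) -[0 in RHS](scale0r (word [::])).
  by rewrite !counitZ !mul0r.
- by rewrite (linhD ln) !counitD hx hy.
- by rewrite (linhZ ln) !counitZ hx.
Qed.

(** The reduced coproduct of a word is a sum over cuts into two shorter nonempty
    words, so words of length at most [r] land in the [r]-th filtration step. *)
Lemma connected_of_coalg_surjection (g : T -> H) :
  coalg_morphism g -> g (word [::]) = uone -> (forall x, exists t, g t = x) ->
  connected H.
Proof.
move=> [lg dg _] g1 gsurj.
have Fw r w : (size w <= r)%N -> filtr r (g (word w)).
  elim: r w => [|r IH] w.
    by rewrite leqn0 size_eq0 => /eqP->; exists 1; rewrite g1 scale1r.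
  case: w => [|v w] wr; first by rewrite g1; apply: filtr_uone.
  rewrite /= /reduced_comul dg [comul _]deconcE (linh_sum (tmap_linear lg lg)).
  rewrite big_ord_recl big_ord_recr take0 drop0 take_oversize ?drop_oversize //=.
  rewrite !tmap_tens // g1 addrA addrK addrC addrK.
  apply: tens_subspace_sum => j; rewrite tmap_tens //.
  apply: tens_subspace_tens; apply: IH; rewrite /= ?size_drop.
    by rewrite add0n size_takel ?(leq_trans (ltn_ord j)) // ltnW ?ltn_ord.
  exact: leq_trans (leq_subr _ _) (wr : (size w <= r)%N).
move=> x; have [t <-] := gsurj x.
elim/word_ind: t {x} => [w||x y [r Fx] [s Fy]|a x [r Fx]].
- by exists (size w); apply: Fw.
- by exists 0%N, 0; rewrite scale0r (linh0 lg).
- exists (maxn r s); rewrite (linhD lg); apply: filtrD.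
    by apply: filtr_leq Fx; apply: leq_maxl.
  by apply: filtr_leq Fy; apply: leq_maxr.
- by exists r; rewrite (linhZ lg); apply: filtrZ.
Qed.

End NestedPrecBialgebra.

(** * Connected bialgebras *)

Section Structure.
Variables (K : fieldType) (H : ctdBialgType K).
Notation T := (tensor_coalg (Prim H)).
Notation psi := (nested_prec (@prim_val K H)).

Lemma prim_val_linear : linear (@prim_val K H).
Proof. by []. Qed.

Lemma nested_prec_Prim_coalg_morphism : coalg_morphism psi.
Proof. exact: nested_prec_coalg_morphism prim_val_linear (@prim_valP K H). Qed.

(** Expanding [x] repeatedly by means of [primitive_projection] writes it as a sum
    of nested products of primitive elements, which terminates on each filtration
    step: this is surjectivity. The coefficients of the expansion recover a word
    from its nested product, which gives injectivity. *)
Lemma nested_prec_Prim_bijective : connected H -> bijective psi.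
Proof.
move=> Hconn; have [q [lq q1 qJ qprec]] := primitive_projection Hconn.
have li := prim_val_linear; have ln := nested_prec_linear li.
have bi := bilin_linear (@prec_bilin K H) li (@linear_id K H).
apply: injective_surjective_bijective => [s t st|x].
  (* The first [n] stages of the expansion, recorded as words; they recover words
     of length less than [n]. *)
  pose word_of := fix word_of n x : T := if n is m.+1
    then aug x *: word [::] + conv (@tcons K (Prim H)) q (word_of m) x else 0.
  have lw n : linear (word_of n).
    elim: n => [|n IH]; first exact: linear_zero.
    apply: linear_add; first exact: aug_scale_linear.
    exact: conv_linear (@tcons_bilin _ _) lq IH.
  have wK t0 : exists N, forall n, (N <= n)%N -> word_of n (psi t0) = t0.
    elim/tens_word_ind: t0 => [|v u [N IH]||x y [N hx] [M hy]|a x [N hx]].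
    - exists 1%N => -[|n] // _; rewrite nested_prec_nil //= aug_one scale1r.
      rewrite conv_uone //; last exact: tcons_bilin.
      by rewrite q1 (bilin0l (@tcons_bilin _ _)) addr0.
    - exists N.+1 => -[|n] // Nn.
      rewrite nested_prec_tcons //= aug_prec scale0r add0r.
      rewrite conv_prec_primitive //; [|exact: tcons_bilin|exact: prim_valP].
      rewrite q1 (bilin0l (@tcons_bilin _ _)) addr0.
      transitivity (conv (@tcons K (Prim H)) (fun y : H => aug y *: v) (word_of n)
                      (psi u)).
        by apply: eq_conv => a b; rewrite -qprec.
      by rewrite conv_augl ?IH //; apply: tcons_bilin.
    - by exists 0%N => n _; rewrite (linh0 ln) (linh0 (lw n)).
    - exists (maxn N M) => n; rewrite geq_max => /andP[Nn Mn].
      by rewrite (linhD ln) (linhD (lw n)) hx // hy.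
    - by exists N => n Nn; rewrite (linhZ ln) (linhZ (lw n)) hx.
  have [N sN] := wK s; have [M tM] := wK t.
  by rewrite -(sN _ (leq_maxl N M)) st tM // leq_maxr.
have [r] := Hconn x; elim: r x => [_ [a ->]|r IH x].
  by exists (a *: word [::]); rewrite (linhZ ln) nested_prec_nil.
case/conv_filtr=> n [u [v [_ Fv cE]]].
have [t tv] := choice (fun i => IH _ (Fv i)).
exists (aug x *: word [::] + tcons (q x) (word [::]) + \sum_i tcons (q (u i)) (t i)).
rewrite !(linhD ln) (linhZ ln) (linh_sum ln) nested_prec_nil //.
rewrite nested_prec_tcons // nested_prec_nil //.
transitivity (aug x *: uone + conv (fun (a : Prim H) y => prec (val a) y) q id x).
  rewrite cE // q1 (bilin0l bi) addr0 addrA; congr (_ + _).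
  by apply: eq_bigr => j _; rewrite nested_prec_tcons // tv.
by rewrite qJ addrC subrK.
Qed.

Notation phi := (UCTD_lift (@prim_val K H)).

Lemma UCTD_lift_Prim_morphism : uctd_morphism phi.
Proof.
apply: UCTD_lift_morphism => // r; exact: primitive_aug (prim_valP r).
Qed.

Lemma UCTD_lift_Prim_gen r : phi (UCTD_gen r) = prim_val r.
Proof.
apply: UCTD_lift_gen => // s; exact: primitive_aug (prim_valP s).
Qed.

Lemma UCTD_lift_Prim_coalg_morphism : coalg_morphism phi.
Proof.
have fm := UCTD_lift_Prim_morphism; have lf := uctdm_linear fm.
split=> // x; last by rewrite !counit_aug (uctdm_aug fm).
have m1 := uctd_morphism_comp fm (@comul_uctd_morphism K H).
have m2 := uctd_morphism_comp (@UCTD_comul_morphism K (Prim H))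
  (tmap_uctd_morphism fm fm).
move: x; apply: (UCTD_morphism_ext m1 m2) => r.
rewrite UCTD_lift_Prim_gen UCTD_comul_gen (linhD (tmap_linear lf lf)) !tmap_tens //.
by rewrite (uctdm_one fm) UCTD_lift_Prim_gen; apply/primitiveP/prim_valP.
Qed.

(** Composing the surjection from the tensor module onto the enveloping algebra
    with the canonical morphism to [H] gives the bijection of
    [nested_prec_Prim_bijective]; hence both factors are bijective. *)
Lemma connected_isomorphic_UCTD :
  connected H -> ctd_bialg_isomorphic H (UCTD (Prim H)).
Proof.
move=> Hconn; have [g psiK gK] := nested_prec_Prim_bijective Hconn.
have fm := UCTD_lift_Prim_morphism; have lg := @UCTD_gen_linear K (Prim H).
have phiE t : phi (nested_prec (@UCTD_gen K (Prim H)) t) = psi t.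
  rewrite (nested_prec_morphism _ fm lg); congr (wlift _ _).
  by apply/funext => w; elim: w => //= v w ->; rewrite UCTD_lift_Prim_gen.
have [f phiK fK] : bijective phi.
  apply: injective_surjective_bijective => [x y|x]; last first.
    by exists (nested_prec (@UCTD_gen K (Prim H)) (g x)); rewrite phiE gK.
  have [s <-] := nested_prec_UCTD_surjective x.
  have [t <-] := nested_prec_UCTD_surjective y.
  by rewrite !phiE => /(can_inj psiK)->.
exists f; split; last by exists phi.
  exact: uctd_morphism_inverse fm phiK fK.
exact: coalg_morphism_inverse UCTD_lift_Prim_coalg_morphism phiK fK.
Qed.

Lemma connected_isomorphic_tensor_coalg :
  connected H -> coalg_isomorphic H (tensor_coalg (Prim H)).
Proof.
move=> /nested_prec_Prim_bijective[g psiK gK]; exists g; split; last by exists psi.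
exact: coalg_morphism_inverse nested_prec_Prim_coalg_morphism psiK gK.
Qed.

(** The generators being primitive, the tensor coalgebra also surjects onto the
    enveloping algebra of any algebra [R]. *)
Lemma isomorphic_UCTD_connected (R : nuComAlgType K) :
  ctd_bialg_isomorphic H (UCTD R) -> connected H.
Proof.
case=> f [fm fc [g fK gK]]; have lg := @UCTD_gen_linear K R.
have rho : coalg_morphism (nested_prec (@UCTD_gen K R)).
  apply: nested_prec_coalg_morphism => // r.
  exact/primitiveP/UCTD_comul_gen.
pose h t := g (nested_prec (@UCTD_gen K R) t).
apply: (@connected_of_coalg_surjection _ R _ h).
- exact: coalg_morphism_comp rho (coalg_morphism_inverse fc fK gK).
- by rewrite /h nested_prec_nil // -(uctdm_one fm) fK.
- move=> x; have [t tE] := nested_prec_UCTD_surjective (f x).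
  by exists t; rewrite /h tE fK.
Qed.

(** A coalgebra isomorphism preserves the units: it sends the unit to a group-like
    element, and the empty word is the only one. *)
Lemma isomorphic_tensor_coalg_connected (V : lmodType K) :
  coalg_isomorphic H (tensor_coalg V) -> connected H.
Proof.
case=> f [fc [g fK gK]]; have [lf df ef] := fc.
apply: (@connected_of_coalg_surjection _ V _ g) => [||x]; last by exists (f x).
  exact: coalg_morphism_inverse fc fK gK.
rewrite -(fK uone); congr (g _); apply/esym/grouplike_nil.
  by rewrite df comul_uone tmap_tens.
by rewrite ef counit_aug aug_one.
Qed.

End Structure.

Theorem theorem4p1 (K : fieldType) (charK : [pchar K] =i pred0)
    (H : ctdBialgType K) :
  [<-> connected H;
       ctd_bialg_isomorphic H (UCTD (Prim H));
       coalg_isomorphic H (tensor_coalg (Prim H))].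
Proof.
tfae.
- exact: connected_isomorphic_UCTD.
- by move/isomorphic_UCTD_connected/connected_isomorphic_tensor_coalg.
- exact: isomorphic_tensor_coalg_connected.
Qed.
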